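(* The variety of complex $3$-dimensional binary $\mathfrak{perm}$ superalgebras of type $(1,2)$ has dimension $4$ and has exactly $8$ irreducible components: $\overline{\mathcal{O}(\mathrm{R}_{04}^{\alpha})},\ \overline{\mathcal{O}(\mathrm{R}_{07}^{\alpha})},\ \overline{\mathcal{O}(\mathrm{R}_{09})},\ \overline{\mathcal{O}(\mathrm{R}_{15})},\ \overline{\mathcal{O}(\mathrm{R}_{17})},\ \overline{\mathcal{O}(\mathrm{R}_{19})},\ \overline{\mathcal{O}(\mathrm{R}_{22})},\ \overline{\mathcal{O}(\mathrm{R}_{24})}$. In particular, exactly $6$ superalgebras are rigid in this variety.
   Context: All algebras are over $\mathbb{C}$. A superalgebra is a $\mathbb{Z}_2$-graded algebra $A=A_0\oplus A_1$ with $A_iA_j\subseteq A_{i+j \bmod 2}$; $|x|\in\{0,1\}$ is the degree of a homogeneous $x$. It has type $(n,m)$ if $\dim A_0=n$, $\dim A_1=m$. The associator is $(x,y,z)=(xy)z-x(yz)$. A binary $\mathfrak{perm}$ superalgebra is a superalgebra satisfying, for all homogeneous $x,y,z$: $(x,y,z)=-(-1)^{|y||z|}(x,z,y)=-(-1)^{|x||y|}(y,x,z)$ and $(xy)z+(-1)^{|x||y|+|x||z|+|y||z|}(zy)x=(-1)^{|y||z|}(xz)y+(-1)^{|x||z|+|y||z|}(zx)y$. Geometric setting: fix a graded space $V=V_0\oplus V_1$ of type $(n,m)$ with a homogeneous basis. Superalgebra structures on $V$ are even bilinear maps $\mu:V\times V\to V$, identified with their structure constants; those satisfying a given family of graded polynomial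 identities form a Zariski-closed subset (an affine variety) of this affine space. The group $GL(V_0)\times GL(V_1)$ acts by $(g*\mu)(x,y)=g\mu(g^{-1}x,g^{-1}y)$; its orbits are the isomorphism classes. $\mathcal{O}(A)$ denotes the orbit of (a structure representing) $A$ and $\overline{\mathcal{O}(A)}$ its Zariski closure; for a family $A^{\alpha}$, $\overline{\mathcal{O}(A^{\alpha})}$ denotes the closure of the union of the orbits of all $A^{\alpha}$ over the admissible parameters $\alpha$. A superalgebra is rigid if its orbit is open in the variety. The dimension of the variety is the maximal dimension of its irreducible components. Superalgebras of type $(1,2)$, in basis $e_1$ (even), $f_1,f_2$ (odd), listed by nonzero products (unlisted products are zero), $\alpha\in\mathbb{C}$: $\mathrm{R}_{04}^{\alpha}$: $f_1f_2=(\alpha+1)e_1,\ f_2f_1=(\alpha-1)e_1$; $\mathrm{R}_{07}^{\alpha}$: $e_1f_1=(1+\alpha)f_2,\ f_1e_1=(1-\alpha)f_2,\ f_1f_1=e_1$; $\mathrm{R}_{09}$: $e_1e_1=e_1,\ f_1e_1=f_1$; $\mathrm{R}_{15}$: $e_1e_1=e_1,\ e_1f_1=f_1,\ f_1e_1=f_1,\ f_2e_1=f_2$; $\mathrm{R}_{17}$: $e_1e_1=e_1,\ e_1f_1=f_1,\ f_1e_1=f_1$; $\mathrm{R}_{19}$: $e_1e_1=e_1$; $\mathrm{R}_{22}$: $e_1e_1=e_1,\ f_1e_1=f_1,\ f_2e_1=f_2$; $\mathrm{R}_{24}$: $e_1e_1=e_1,\ e_1f_1=f_1,\ f_1e_1=f_1,\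 e_1f_2=f_2,\ f_2e_1=f_2$. *)

(* Defs.v *)
From mathcomp Require Import all_boot all_algebra.
From mathcomp Require Import reals complex.
Set Implicit Arguments. Unset Strict Implicit. Unset Printing Implicit Defensive.
Import GRing.Theory Num.Theory.
Local Open Scope ring_scope.

Section Defs.
Variable R : realType.
Notation C := (R[i]).

(* Basis of V: index 0 = e1 (even), 1 = f1, 2 = f2 (odd). *)
Definition sdeg (i : 'I_3) : bool := i != ord0.

(* A superalgebra structure on V: structure constants mu (i,j,k) =
   coefficient of b_k in b_i b_j. *)
Definition idx := ('I_3 * 'I_3 * 'I_3)%type.
Definition struct := idx -> C.
Definition vec := 'I_3 -> C.

Definition smul (mu : struct) (x y : vec) : vec :=
  fun k => \sum_(i < 3) \sum_(j < 3) x i * y j * mu (i, j, k).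

Definition associator (mu : struct) (x y z : vec) : vec :=
  fun k => smul mu (smul mu x y) z k - smul mu x (smul mu y z) k.

Definition homog (x : vec) (d : bool) : Prop := forall i, sdeg i != d -> x i = 0.

Definition sg (b : bool) : C := if b then -1 else 1.

Definition is_even (mu : struct) : Prop :=
  forall i j k : 'I_3, sdeg k != addb (sdeg i) (sdeg j) -> mu (i, j, k) = 0.

Definition is_binary_perm (mu : struct) : Prop :=
  forall (x y z : vec) (dx dy dz : bool),
    homog x dx -> homog y dy -> homog z dz ->
    (forall k, associator mu x y z k = - sg (dy && dz) * associator mu x z y k) /\
    (forall k, associator mu x y z k = - sg (dx && dy) * associator mu y x z k) /\
    (forall k, smul mu (smul mu x y) z k
               + sg (addb (addb (dx && dy) (dx && dz)) (dy && dz))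
                 * smul mu (smul mu z y) x k
             = sg (dy && dz) * smul mu (smul mu x z) y k
               + sg (addb (dx && dz) (dy && dz)) * smul mu (smul mu z x) y k).

Definition Var (mu : struct) : Prop := is_even mu /\ is_binary_perm mu.

Inductive polyfun : (struct -> C) -> Prop :=
| pf_const (c : C) : polyfun (fun _ => c)
| pf_coord (t : idx) : polyfun (fun mu => mu t)
| pf_add f g : polyfun f -> polyfun g -> polyfun (fun mu => f mu + g mu)
| pf_mul f g : polyfun f -> polyfun g -> polyfun (fun mu => f mu * g mu).

Definition zclosed (S : struct -> Prop) : Prop :=
  exists F : (struct -> C) -> Prop, (forall f, F f -> polyfun f) /\
    forall mu, S mu <-> (forall f, F f -> f mu = 0).

Definition ssubset (A B : struct -> Prop) : Prop := forall mu, A mu -> B mu.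
Definition seteq (A B : struct -> Prop) : Prop := forall mu, A mu <-> B mu.

Definition zclosure (S : struct -> Prop) : struct -> Prop :=
  fun mu => forall Z, zclosed Z -> ssubset S Z -> Z mu.

Definition zirreducible (S : struct -> Prop) : Prop :=
  (exists mu, S mu) /\
  forall A B, zclosed A -> zclosed B ->
    ssubset S (fun mu => A mu \/ B mu) -> ssubset S A \/ ssubset S B.

Definition irr_component (X Z : struct -> Prop) : Prop :=
  zclosed Z /\ zirreducible Z /\ ssubset Z X /\
  forall W, zclosed W -> zirreducible W -> ssubset W X -> ssubset Z W -> seteq W Z.

Definition has_chain (X : struct -> Prop) (n : nat) : Prop :=
  exists Z : nat -> struct -> Prop,
    (forall m, (m <= n)%N -> zclosed (Z m) /\ zirreducible (Z m) /\ ssubset (Z m) X) /\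
    (forall m, (m < n)%N -> ssubset (Z m) (Z m.+1) /\ ~ ssubset (Z m.+1) (Z m)).

Definition has_dim (X : struct -> Prop) (n : nat) : Prop :=
  has_chain X n /\ ~ has_chain X n.+1.

Definition graded_GL (g : 'M[C]_3) : Prop :=
  g \in unitmx /\ forall i j : 'I_3, sdeg i != sdeg j -> g i j = 0.

Definition mapply (M : 'M[C]_3) (x : vec) : vec := fun k => \sum_(l < 3) M k l * x l.
Definition ebasis (i : 'I_3) : vec := fun l => (l == i)%:R.

Definition sact (g : 'M[C]_3) (mu : struct) : struct :=
  fun t => let: (i, j, k) := t in
    mapply g (smul mu (mapply (invmx g) (ebasis i)) (mapply (invmx g) (ebasis j))) k.

Definition sorbit (mu : struct) : struct -> Prop :=
  fun nu => exists g, graded_GL g /\ nu = sact g mu.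

Definition fam_orbit (F : C -> struct) : struct -> Prop :=
  fun nu => exists a : C, sorbit (F a) nu.

Definition rigid (X : struct -> Prop) (mu : struct) : Prop :=
  X mu /\ exists Z, zclosed Z /\ forall nu, X nu -> (sorbit mu nu <-> ~ Z nu).

Local Open Scope nat_scope.
Definition R04 (a : C) : struct := fun t => let: (i, j, k) := t in
  match nat_of_ord i, nat_of_ord j, nat_of_ord k with
  | 1, 2, 0 => (a + 1)%R | 2, 1, 0 => (a - 1)%R | _, _, _ => 0%R end.
Definition R07 (a : C) : struct := fun t => let: (i, j, k) := t in
  match nat_of_ord i, nat_of_ord j, nat_of_ord k with
  | 0, 1, 2 => (1 + a)%R | 1, 0, 2 => (1 - a)%R | 1, 1, 0  => 1%R | _, _, _ => 0%R end.
Definition R09 : struct := fun t => let: (i, j, k) := t in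
  match nat_of_ord i, nat_of_ord j, nat_of_ord k with
  | 0, 0, 0  => 1%R | 1, 0, 1  => 1%R | _, _, _ => 0%R end.
Definition R15 : struct := fun t => let: (i, j, k) := t in
  match nat_of_ord i, nat_of_ord j, nat_of_ord k with
  | 0, 0, 0  => 1%R | 0, 1, 1  => 1%R | 1, 0, 1  => 1%R | 2, 0, 2  => 1%R
  | _, _, _ => 0%R end.
Definition R17 : struct := fun t => let: (i, j, k) := t in
  match nat_of_ord i, nat_of_ord j, nat_of_ord k with
  | 0, 0, 0  => 1%R | 0, 1, 1  => 1%R | 1, 0, 1  => 1%R | _, _, _ => 0%R end.
Definition R19 : struct := fun t => let: (i, j, k) := t in
  match nat_of_ord i, nat_of_ord j, nat_of_ord k with
  | 0, 0, 0  => 1%R | _, _, _ => 0%R end.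
Definition R22 : struct := fun t => let: (i, j, k) := t in
  match nat_of_ord i, nat_of_ord j, nat_of_ord k with
  | 0, 0, 0  => 1%R | 1, 0, 1  => 1%R | 2, 0, 2  => 1%R | _, _, _ => 0%R end.
Definition R24 : struct := fun t => let: (i, j, k) := t in
  match nat_of_ord i, nat_of_ord j, nat_of_ord k with
  | 0, 0, 0  => 1%R | 0, 1, 1  => 1%R | 1, 0, 1  => 1%R | 0, 2, 2  => 1%R | 2, 0, 2  => 1%R
  | _, _, _ => 0%R end.

Definition comp8 (k : 'I_8) : struct -> Prop :=
  match nat_of_ord k with
  | 0 => zclosure (fam_orbit R04)
  | 1 => zclosure (fam_orbit R07)
  | 2 => zclosure (sorbit R09)
  | 3 => zclosure (sorbit R15)
  | 4 => zclosure (sorbit R17)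
  | 5 => zclosure (sorbit R19)
  | 6 => zclosure (sorbit R22)
  | _ => zclosure (sorbit R24)
  end.

Definition rig6 (k : 'I_6) : struct :=
  match nat_of_ord k with
  | 0 => R09 | 1 => R15 | 2 => R17 | 3 => R19 | 4 => R22 | _ => R24
  end.

Local Open Scope ring_scope.
End Defs.

(* Main.v *)
Require Import Defs.
From mathcomp Require Import all_boot all_algebra.
From mathcomp Require Import reals complex.
From mathcomp Require Import ring zify.
From mathcomp Require boolp.
Set Implicit Arguments. Unset Strict Implicit. Unset Printing Implicit Defensive.
Import GRing.Theory Num.Theory.
Local Open Scope ring_scope.

(* Write a for the constant in e1 e1 = a e1, lam and rho for left and right
   multiplication by e1 on the odd part, and B for the odd product. The identities
   force lam^2 = a lam, rho^2 = a rho and lam rho = rho lam = a lam. If a <> 0, then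
   B = 0 and the structure is determined by the ranks of the commuting idempotents
   lam / a and rho / a: six orbits, separated by the traces of lam and rho. If a = 0,
   then either lam = rho = 0 and B is arbitrary, or lam and rho are multiples of one
   nilpotent N and B is a multiple of w (x) w, where w spans the annihilator of ker N.
   This covers the variety by the images of eight polynomial maps from C^4.

   Irreducibility and density are tested along polynomial curves, and so reduce to
   polynomials in one variable. For the upper bound on the dimension, a chain of
   length n yields n polynomials algebraically independent on its largest member,
   whereas five polynomials on C^4 are always dependent, by counting monomials
   against the points of a grid on which polynomials of bounded degree are determined. *)

(** * Zariski closed and irreducible sets *)

Section PolynomialFunctions.
Variable R : realType.
Local Notation C := (R[i]).
Local Notation struct := (struct R).
Implicit Types (f g : struct -> C) (S T Z : struct -> Prop).

Lemma polyfun_ext f g : f =1 g -> polyfun f -> polyfun g.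
Proof. by move=> /boolp.funext ->. Qed.

Lemma polyfun_opp f : polyfun f -> polyfun (fun mu => - f mu).
Proof.
move=> pf; apply: (polyfun_ext _ (pf_mul (pf_const (-1)) pf)) => mu.
by rewrite mulN1r.
Qed.

Lemma polyfun_sub f g : polyfun f -> polyfun g -> polyfun (fun mu => f mu - g mu).
Proof. by move=> pf /polyfun_opp pg; apply: (pf_add pf pg). Qed.

Lemma polyfun_exp f n : polyfun f -> polyfun (fun mu => f mu ^+ n).
Proof.
move=> pf; elim: n => [|n IHn].
  by apply: (polyfun_ext _ (pf_const 1)) => mu; rewrite expr0.
by apply: (polyfun_ext _ (pf_mul pf IHn)) => mu; rewrite exprS.
Qed.

Lemma polyfun_sum (I : Type) (r : seq I) (P : pred I) (F : I -> struct -> C) :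
  (forall i, polyfun (F i)) -> polyfun (fun mu => \sum_(i <- r | P i) F i mu).
Proof.
move=> pF; elim: r => [|i r IHr].
  by apply: (polyfun_ext _ (pf_const 0)) => mu; rewrite big_nil.
case Pi: (P i); last by apply: (polyfun_ext _ IHr) => mu; rewrite big_cons Pi.
by apply: (polyfun_ext _ (pf_add (pF i) IHr)) => mu; rewrite big_cons Pi.
Qed.

Lemma zclosed_eqs (I : Type) (f : I -> struct -> C) :
  (forall i, polyfun (f i)) -> zclosed (fun mu => forall i, f i mu = 0).
Proof.
move=> pf; exists (fun g => exists i, g = f i); split; first by move=> _ [i ->].
by move=> mu; split=> [h _ [i ->]|h i]; [exact: h | apply: h; exists i].
Qed.

Lemma zclosed_eq f : polyfun f -> zclosed (fun mu => f mu = 0).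
Proof.
move=> pf; have [F [pF FE]] := @zclosed_eqs unit (fun=> f) (fun=> pf).
by exists F; split=> // mu; rewrite -FE; split=> [|/(_ tt)].
Qed.

(** Taking as equations all polynomials that vanish on some member avoids choosing a defining family
    for each member. *)
Lemma zclosed_inter (I : Type) (Z : I -> struct -> Prop) :
  (forall i, zclosed (Z i)) -> zclosed (fun mu => forall i, Z i mu).
Proof.
move=> cZ; exists (fun f => polyfun f /\ exists i, forall mu, Z i mu -> f mu = 0).
split=> [f []//|mu]; split=> [h f [_ [i fi]]|h i]; first exact/fi/h.
have [F [pF FE]] := cZ i.
by apply/FE => f Ff; apply: h; split; [exact: pF | exists i => nu /FE; apply].
Qed.

Lemma zclosed_iff Z T : seteq Z T -> zclosed Z -> zclosed T.
Proof.
by move=> ZT [F [pF FE]]; exists F; split=> // mu; rewrite -ZT.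
Qed.

Lemma zclosedI Z T : zclosed Z -> zclosed T -> zclosed (fun mu => Z mu /\ T mu).
Proof.
move=> cZ cT.
apply: (@zclosed_iff _ _ _ (@zclosed_inter bool (fun b => if b then Z else T) _)).
  by move=> mu; split=> [h|[hZ hT] []//]; split; [exact: (h true) | exact: (h false)].
by case.
Qed.

Lemma zclosed_sep Z mu : zclosed Z -> ~ Z mu ->
  exists f, [/\ polyfun f, forall nu, Z nu -> f nu = 0 & f mu != 0].
Proof.
move=> [F [pF FE]] nZ; apply: boolp.contrapT => h; apply/nZ/FE => f Ff.
apply/eqP; apply: boolp.contrapT => /negP fmu; apply: h; exists f.
by split=> //; [exact: pF | move=> nu /FE; apply].
Qed.

Lemma ssubset_sep Z T : zclosed Z -> ~ ssubset T Z ->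
  exists f, [/\ polyfun f, forall nu, Z nu -> f nu = 0 & exists2 mu, T mu & f mu != 0].
Proof.
move=> cZ nTZ; have [mu [Tmu nZmu]] : exists mu, T mu /\ ~ Z mu.
  apply: boolp.contrapT => h; apply: nTZ => mu Tmu; apply: boolp.contrapT => nZ.
  by apply: h; exists mu.
by have [f [pf fZ fmu]] := zclosed_sep cZ nZmu; exists f; split=> //; exists mu.
Qed.

Lemma sub_zclosure S : ssubset S (zclosure S).
Proof. by move=> mu Smu Z _; apply. Qed.

Lemma zclosure_min S Z : zclosed Z -> ssubset S Z -> ssubset (zclosure S) Z.
Proof. by move=> cZ SZ mu; apply. Qed.

Lemma zclosed_zclosure S : zclosed (zclosure S).
Proof.
exists (fun f => polyfun f /\ forall mu, S mu -> f mu = 0); split=> [f []//|mu].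
split=> [h f [pf fS]|h Z cZ SZ]; first by apply: (h _ (zclosed_eq pf)).
apply: boolp.contrapT => /(zclosed_sep cZ) [f [pf fZ]] /eqP; apply.
by apply: h; split=> // nu /SZ/fZ.
Qed.

Lemma zclosure_sub S T : ssubset S (zclosure T) -> ssubset (zclosure S) (zclosure T).
Proof. by move=> h; apply: zclosure_min => //; apply: zclosed_zclosure. Qed.

Lemma zirreducible_zclosure S : zirreducible S -> zirreducible (zclosure S).
Proof.
move=> [[mu Smu] irrS]; split; first by exists mu; exact: sub_zclosure.
move=> A B cA cB SAB; have [] := irrS _ _ cA cB.
- by move=> nu /sub_zclosure/SAB.
- by left; exact: zclosure_min.
- by right; exact: zclosure_min.
Qed.

Lemma zirreducible_mul Z f g : zirreducible Z -> polyfun f -> polyfun g ->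
  (forall mu, Z mu -> f mu * g mu = 0) ->
  (forall mu, Z mu -> f mu = 0) \/ (forall mu, Z mu -> g mu = 0).
Proof.
move=> [_ irrZ] pf pg fg; apply: irrZ (zclosed_eq pf) (zclosed_eq pg) _.
by move=> mu /fg/eqP; rewrite mulf_eq0 => /orP[]/eqP; [left | right].
Qed.

Lemma polyfun_prod n (F : 'I_n -> struct -> C) :
  (forall i, polyfun (F i)) -> polyfun (fun mu => \prod_(i < n) F i mu).
Proof.
elim: n F => [|n IHn] F pF.
  by apply: (polyfun_ext _ (pf_const 1)) => mu; rewrite big_ord0.
apply: (polyfun_ext _ (pf_mul (pF ord0) (IHn _ (fun i => pF (lift ord0 i))))) => mu.
by rewrite big_ord_recl.
Qed.

Lemma zirreducible_prod n (F : 'I_n -> struct -> C) Z :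
  zirreducible Z -> (forall i, polyfun (F i)) ->
  (forall mu, Z mu -> \prod_(i < n) F i mu = 0) ->
  exists i, forall mu, Z mu -> F i mu = 0.
Proof.
move=> irrZ; elim: n F => [|n IHn] F pF F0.
  have [[mu /F0]] := irrZ; rewrite big_ord0 => /eqP; by rewrite oner_eq0.
have [|h|h] := zirreducible_mul irrZ (pF ord0) (polyfun_prod (fun i => pF (lift ord0 i))).
- by move=> mu /F0; rewrite big_ord_recl.
- by exists ord0.
- by have [i hi] := IHn _ (fun i => pF (lift ord0 i)) h; exists (lift ord0 i).
Qed.

(** Otherwise each [D k] has a polynomial vanishing on it but not on all of [W]. The product of
    these vanishes on [W], so by irreducibility one factor does. *)
Lemma zirreducible_cover n (D : 'I_n -> struct -> Prop) W :
  (forall k, zclosed (D k)) -> zirreducible W ->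
  (forall mu, W mu -> exists k, D k mu) -> exists k, ssubset W (D k).
Proof.
move=> cD irrW WD; apply: boolp.contrapT => nW.
have /boolp.choice[f hf] : forall k, exists f, [/\ polyfun f,
    forall nu, D k nu -> f nu = 0 & exists2 mu, W mu & f mu != 0].
  by move=> k; apply: ssubset_sep => // WDk; apply: nW; exists k.
have [k|mu Wmu|k fk] := zirreducible_prod (F := f) irrW; first by have [] := hf k.
  have [k Dk] := WD _ Wmu; have [_ fk _] := hf k.
  by rewrite (bigD1 k) //= fk ?mul0r.
by have [_ _ [mu Wmu]] := hf k; rewrite fk ?eqxx.
Qed.

(** * Polynomial curves in the space of structures *)

Definition curve := idx -> {poly C}.
Definition at_ (c : curve) (t : C) : struct := fun i => (c i).[t].

Lemma polyfun_curve f (c : curve) : polyfun f -> exists p, forall t, f (at_ c t) = p.[t].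
Proof.
elim=> [k|i|{}f g _ [p fp] _ [q gq]|{}f g _ [p fp] _ [q gq]].
- by exists k%:P => t; rewrite hornerC.
- by exists (c i).
- by exists (p + q) => t; rewrite hornerD fp gq.
- by exists (p * q) => t; rewrite hornerM fp gq.
Qed.

Lemma nat_poly_eq0 (p : {poly C}) : (forall n : nat, (n < size p)%N -> p.[n%:R] = 0) -> p = 0.
Proof.
move=> h; apply: (@roots_geq_poly_eq0 _ _ [seq n%:R | n <- iota 0 (size p)]).
- by apply/allP => _ /mapP[n + ->]; rewrite mem_iota => /h/eqP.
- by rewrite map_inj_uniq ?iota_uniq // => m n /eqP; rewrite eqr_nat => /eqP.
- by rewrite size_map size_iota.
Qed.

Lemma horner_eq0 (p : {poly C}) : (forall t, p.[t] = 0) -> p = 0.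
Proof. by move=> h; apply: nat_poly_eq0. Qed.

Lemma horner_neq0_eq0 (p w : {poly C}) :
  w != 0 -> (forall t, w.[t] != 0 -> p.[t] = 0) -> p = 0.
Proof.
move=> w0 h; apply/eqP; rewrite -[p == 0]orbF -(negPf w0) -mulf_eq0; apply/eqP.
apply: horner_eq0 => t; rewrite hornerM; case: (eqVneq w.[t] 0) => [->|/h->].
  by rewrite mulr0.
by rewrite mul0r.
Qed.

(** A polynomial vanishing on [D] pulls back to a one-variable polynomial that is zero wherever [w]
    is not, hence identically zero, even if [w] vanishes at the endpoint 0. *)
Lemma sub_zclosure_curve S D :
  (forall mu, S mu -> exists (c : curve) (w : {poly C}),
     [/\ w != 0, at_ c 0 = mu & forall t, w.[t] != 0 -> D (at_ c t)]) ->
  ssubset S (zclosure D).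
Proof.
move=> h mu /h [c [w [w0 <- cD]]] Z cZ DZ; apply: boolp.contrapT.
move=> /(zclosed_sep cZ)[f [pf fZ]]; have [p fp] := polyfun_curve c pf.
rewrite fp (@horner_neq0_eq0 p w w0) ?horner0 ?eqxx // => t /cD/DZ/fZ.
by rewrite fp.
Qed.

(** Join a point where [f] is nonzero to a point where [g] is nonzero. Along the curve the product
    of the two pullbacks is zero although neither pullback is. *)
Lemma zirreducible_curve S : (exists mu, S mu) ->
  (forall mu nu, S mu -> S nu -> exists c : curve,
     [/\ at_ c 0 = mu, at_ c 1 = nu & forall t, S (at_ c t)]) ->
  zirreducible S.
Proof.
move=> S0 hS; split=> // A B cA cB SAB; apply: boolp.contrapT => /boolp.not_orP[nA nB].
have [f [pf fA [mu Smu fmu]]] := ssubset_sep cA nA.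
have [g [pg gB [nu Snu gnu]]] := ssubset_sep cB nB.
have [c [c0 c1 cS]] := hS _ _ Smu Snu.
have [p fp] := polyfun_curve c pf; have [q gq] := polyfun_curve c pg.
have /eqP : p * q = 0.
  apply: horner_eq0 => t; rewrite hornerM -fp -gq.
  by case: (SAB _ (cS t)) => [/fA->|/gB->]; rewrite ?mul0r ?mulr0.
rewrite mulf_eq0 => /orP[]/eqP z.
  by move: fmu; rewrite -c0 fp z horner0 eqxx.
by move: gnu; rewrite -c1 gq z horner0 eqxx.
Qed.
End PolynomialFunctions.

(** * Length of chains *)

Section Dimension.
Variable R : realType.
Local Notation C := (R[i]).
Local Notation struct := (struct R).

Fixpoint expo (N k : nat) : finType :=
  if k is k'.+1 then ('I_N * expo N k')%type else unit.

Lemma card_expo N k : #|expo N k| = (N ^ k)%N.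
Proof. by elim: k => [|k IHk] /=; rewrite ?card_unit // card_prod IHk card_ord expnS. Qed.

(** The head of an exponent vector belongs to the function of largest index, so that induction on
    [k] splits off the newest function. *)
Fixpoint mono (h : nat -> struct -> C) N k : expo N k -> struct -> C :=
  if k is k'.+1 then fun m mu => h k' mu ^+ m.1 * mono h m.2 mu else fun _ _ => 1.

Lemma polyfun_mono h N k (m : expo N k) : (forall i, polyfun (h i)) -> polyfun (mono h m).
Proof.
move=> ph; elim: k m => [|k IHk] m /=; first exact: pf_const.
by apply: pf_mul; [exact: polyfun_exp | exact: IHk].
Qed.

(* A nonzero function vanishing on the smaller closed set of a strict inclusion
   of irreducible closed sets is transcendental over functions that are
   algebraically independent on the smaller set. *)
Lemma chain_independent n (Z : nat -> struct -> Prop) (h : nat -> struct -> C) :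
  (forall m, (m <= n)%N -> zirreducible (Z m)) ->
  (forall m, (m < n)%N -> ssubset (Z m) (Z m.+1)) ->
  (forall m, polyfun (h m)) ->
  (forall m, (m < n)%N -> forall mu, Z m mu -> h m mu = 0) ->
  (forall m, (m < n)%N -> exists2 mu, Z m.+1 mu & h m mu != 0) ->
  forall N k (c : expo N k -> C), (k <= n)%N ->
  (forall mu, Z k mu -> \sum_m c m * mono h m mu = 0) -> forall m, c m = 0.
Proof.
move=> irrZ sZ ph h0 hn0 N; elim=> [|k IHk] c kn rel.
  have [[mu /rel + _]] := irrZ 0%N kn; rewrite (big_pred1 tt) => [+ [] /=|[]//].
  by rewrite mulr1.
(* The relation is read as a polynomial in [h k], whose coefficients [A j] involve only the earlier
   functions. *)
pose A j mu := \sum_(m : expo N k) c (j, m) * mono h m mu.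
have pA j : polyfun (A j).
  by apply: polyfun_sum => m; apply: pf_mul; [exact: pf_const | exact: polyfun_mono].
have relA mu : Z k.+1 mu -> \sum_(j < N) h k mu ^+ j * A j mu = 0.
  move=> /rel rel0; rewrite -[RHS]rel0.
  transitivity (\sum_(j < N) \sum_(m : expo N k) c (j, m) * (h k mu ^+ j * mono h m mu)).
    by apply: eq_bigr => j _; rewrite mulr_sumr; apply: eq_bigr => m _; rewrite mulrCA.
  by rewrite pair_bigA; apply: eq_bigr => -[j m] _.
suff c0 j (jN : (j < N)%N) m : c (Ordinal jN, m) = 0.
  by case=> -[j jN] m; exact: c0.
(* With the coefficients below [j] gone, [h k ^+ j] factors out, and irreducibility of [Z k.+1]
   cancels it. On [Z k], where [h k] is zero, only [A j] survives, and the induction on [k]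
   applies. *)
elim/ltn_ind: j => j IHj in jN m *.
have pT : polyfun (fun mu => \sum_(i < N | (j <= i)%N) h k mu ^+ (i - j) * A i mu).
  by apply: polyfun_sum => i; apply: pf_mul => //; exact: polyfun_exp.
have [mu Zmu|h0'|T0] := zirreducible_mul (irrZ _ kn) (polyfun_exp j (ph k)) pT.
- rewrite mulr_sumr -[RHS](relA _ Zmu) [RHS](bigID (fun i : 'I_N => (j <= i)%N)) /=.
  rewrite [X in _ = _ + X]big1 ?addr0 => [|[i iN] /=].
    by apply: eq_bigr => i ji; rewrite mulrA -exprD subnKC.
  rewrite -ltnNge => ij; rewrite [A _ _]big1 ?mulr0 // => m' _.
  by rewrite IHj // mul0r.
- have [mu /h0' /eqP + hmu] := hn0 _ kn; by rewrite expf_eq0 (negPf hmu) andbF.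
apply: (IHk (fun m => c (Ordinal jN, m)) (ltnW kn)) => mu Zmu.
have := T0 mu (sZ _ kn _ Zmu); rewrite (bigD1 (Ordinal jN)) //= subnn mul1r.
rewrite big1 ?addr0 // => i /andP[ji neq]; rewrite (h0 _ kn) // expr0n subn_eq0.
case: leqP => [ij|]; last by rewrite mul0r.
by case/eqP: neq; apply: val_inj => /=; apply/eqP; rewrite eqn_leq ij.
Qed.

(** * Functions of bounded degree in each variable *)

Section SeparateDegree.
Variable n : nat.
Implicit Types (f g : ('I_n -> C) -> C) (x : 'I_n -> C).

Definition upd x i t : 'I_n -> C := fun j => if j == i then t else x j.

Definition sepdeg (d : nat) f := forall i x,
  exists2 p : {poly C}, (size p <= d.+1)%N & forall t, f (upd x i t) = p.[t].

Lemma sepdeg_const c : sepdeg 0 (fun=> c).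
Proof. by move=> i x; exists c%:P => [|t]; rewrite ?hornerC ?size_polyC_leq1. Qed.

Lemma sepdeg_coord i : sepdeg 1 (fun x => x i).
Proof.
move=> j x; rewrite /upd; case: (i == j); first by exists 'X => [|t]; rewrite ?size_polyX ?hornerX.
by exists (x i)%:P => [|t]; rewrite ?hornerC //; apply: leq_trans (size_polyC_leq1 _) _.
Qed.

Lemma sepdegW d e f : (d <= e)%N -> sepdeg d f -> sepdeg e f.
Proof.
by move=> de fd i x; have [p sp fp] := fd i x; exists p => //; apply: leq_trans sp _.
Qed.

Lemma sepdegD d f g : sepdeg d f -> sepdeg d g -> sepdeg d (fun x => f x + g x).
Proof.
move=> fd gd i x; have [p sp fp] := fd i x; have [q sq gq] := gd i x.
exists (p + q) => [|t]; last by rewrite hornerD fp gq.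
by apply: leq_trans (size_polyD _ _) _; rewrite geq_max sp.
Qed.

Lemma sepdegM d e f g : sepdeg d f -> sepdeg e g -> sepdeg (d + e) (fun x => f x * g x).
Proof.
move=> fd ge i x; have [p sp fp] := fd i x; have [q sq gq] := ge i x.
exists (p * q) => [|t]; last by rewrite hornerM fp gq.
by apply: leq_trans (size_polyMleq _ _) _; lia.
Qed.

Lemma sepdegX d f k : sepdeg d f -> sepdeg (k * d) (fun x => f x ^+ k).
Proof.
move=> fd; elim: k => [|k IHk]; first exact: sepdeg_const.
by rewrite mulSn (boolp.funext (fun x => exprS (f x) k)); exact: sepdegM.
Qed.

Lemma sepdeg_sum (I : Type) (r : seq I) (F : I -> ('I_n -> C) -> C) d :
  (forall i, sepdeg d (F i)) -> sepdeg d (fun x => \sum_(i <- r) F i x).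
Proof.
move=> Fd; elim: r => [|i r IHr].
  rewrite (boolp.funext (fun x => big_nil _ _ _ (fun i => F i x))).
  exact: sepdegW (sepdeg_const 0).
rewrite (boolp.funext (fun x => big_cons _ _ _ _ _ (fun i => F i x))).
exact: sepdegD.
Qed.

(** The coordinates are released from the grid one at a time: a polynomial of degree at most [d]
    that vanishes at 0, ..., [d] is zero. *)
Lemma sepdeg_grid d f : sepdeg d f ->
  (forall m : {ffun 'I_n -> 'I_d.+1}, f (fun i => (m i)%:R) = 0) -> forall x, f x = 0.
Proof.
move=> fd f0 x.
(* The coordinates of index below [k] are arbitrary, the others still lie on the grid. *)
suff H k : forall x, (forall i : 'I_n, (k <= i)%N -> exists m : 'I_d.+1, x i = m%:R) -> f x = 0.
  by apply: (H n) => i; rewrite leqNgt ltn_ord.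
elim: k => [|k IHk] {}x hx.
  have /boolp.choice[m mx] : forall i, exists m : 'I_d.+1, x i = m%:R by move=> i; apply: hx.
  rewrite -(f0 [ffun i => m i]); congr f; apply: boolp.funext => i.
  by rewrite ffunE.
have [kn|nk] := ltnP k n; last first.
  by apply: IHk => i ki; move: (ltn_ord i); lia.
pose i := Ordinal kn; have [p sp fp] := fd i x.
have xE : upd x i (x i) = x.
  by apply: boolp.funext => j; rewrite /upd; case: eqP => // ->.
rewrite -xE fp (@nat_poly_eq0 _ p) ?horner0 // => t tp.
rewrite -fp; apply: IHk => j kj; rewrite /upd; case: eqP => [_|/eqP ji].
  by exists (Ordinal (leq_trans tp sp)).
by apply: hx; rewrite ltn_neqAle kj andbT; apply: contra ji => /eqP e; apply/eqP/val_inj.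
Qed.
End SeparateDegree.

Lemma lin_dependent (I J : finType) (A : I -> J -> C) : (#|J| < #|I|)%N ->
  exists2 c : I -> C, (exists i, c i != 0) & forall j, \sum_i c i * A i j = 0.
Proof.
move=> ltJI; pose B := \matrix_(i < #|I|, j < #|J|) A (enum_val i) (enum_val j).
have : kermx B != 0.
  by rewrite kermx_eq0 /row_free neq_ltn (leq_ltn_trans (rank_leq_col _)).
case/rowV0Pn => v /sub_kermxP vB v0; exists (fun i => v 0 (enum_rank i)).
  by have [k vk] := rV0Pn _ v0; exists (enum_val k); rewrite enum_valK.
move=> j; have := congr1 (fun M : 'rV_#|J| => M 0 (enum_rank j)) vB.
rewrite !mxE => vB0; rewrite -[RHS]vB0 (reindex_onto enum_val enum_rank) => [|i _];
  last exact: enum_rankK.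
apply: eq_big => [k|k _]; first by rewrite enum_valK eqxx.
by rewrite !mxE enum_rankK enum_valK.
Qed.

(** For large [N] there are more monomials in [n + 1] functions with exponents below [N] than points
    in a grid that determines their pullbacks. Linear algebra then yields a relation on the grid,
    hence everywhere. *)
Lemma param_dependent n (phi : ('I_n -> C) -> struct) (h : nat -> struct -> C) :
  (forall t, exists d, sepdeg d (fun x => phi x t)) -> (forall i, polyfun (h i)) ->
  exists N (c : expo N n.+1 -> C),
    (exists m, c m != 0) /\ forall x, \sum_m c m * mono h m (phi x) = 0.
Proof.
move=> phid ph.
have hd f : polyfun f -> exists d, sepdeg d (fun x => f (phi x)).
  elim=> [k|t|{}f g _ [d fd] _ [e ge]|{}f g _ [d fd] _ [e ge]].
  - by exists 0%N; exact: sepdeg_const.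
  - exact: phid.
  - by exists (d + e)%N; apply: sepdegD; [apply: sepdegW fd|apply: sepdegW ge]; lia.
  - by exists (d + e)%N; apply: sepdegM.
have /boolp.choice[e he] : forall i, exists d, sepdeg d (fun x => h i (phi x)).
  by move=> i; apply: hd.
pose d := (\sum_(i < n.+1) e i)%N.
have {}he i : (i < n.+1)%N -> sepdeg d (fun x => h i (phi x)).
  by move=> ik; apply: sepdegW (he i); rewrite /d (bigD1 (Ordinal ik)) //= leq_addr.
(* With [M = (n + 1) N d] one has [M + 1 <= N ((n + 1) d + 1)]. Hence the [(M + 1) ^ n] grid points
   number at most [N ^ n (N - 1)], fewer than the [N ^ (n + 1)] monomials. *)
pose N := ((n.+1 * d).+1 ^ n).+1; exists N.
have monod k (m : expo N k) : (k <= n.+1)%N -> sepdeg (k * N * d) (fun x => mono h m (phi x)).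
  elim: k m => [|k IHk] m kn /=; first exact: sepdeg_const.
  rewrite mulSn mulnDl; apply: sepdegM; last exact: IHk (ltnW kn).
  by apply: sepdegW (sepdegX _ (he _ kn)); rewrite leq_mul2r ltnW ?orbT.
pose M := (n.+1 * N * d)%N.
have [|c c0 rel] := @lin_dependent (expo N n.+1) {ffun 'I_n -> 'I_M.+1}
    (fun m p => mono h m (phi (fun i => (p i)%:R))).
  rewrite card_expo card_ffun !card_ord expnS.
  apply: (@leq_ltn_trans ((N * (n.+1 * d).+1) ^ n)).
    have expW a b k : (a <= b)%N -> (a ^ k <= b ^ k)%N.
      by move=> ab; elim: k => // k IHk; rewrite !expnS leq_mul.
    by apply: expW; rewrite /M /N; nia.
  by rewrite expnMn mulnC ltn_mul2r expn_gt0 /= ltnS leqnn.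
exists c; split=> //; apply: (@sepdeg_grid n M) => [|p]; last exact: rel.
apply: sepdeg_sum => m; apply: (@sepdegM n 0 M (fun=> c m) (fun x => mono h m (phi x))).
  exact: sepdeg_const.
exact: monod.
Qed.

(** The top of a chain is irreducible, so it lies in the closure of a single image. The functions
    separating consecutive members are independent on the top, but [n + 1] functions on the image of
    an [n]-dimensional space are dependent. *)
Lemma has_chainPn n (X : struct -> Prop) (K : nat) (phi : 'I_K -> ('I_n -> C) -> struct) :
  (forall k t, exists d, sepdeg d (fun x => phi k x t)) ->
  (forall mu, X mu -> exists k, zclosure (fun nu => exists x, nu = phi k x) mu) ->
  ~ has_chain X n.+1.
Proof.
move=> phid Xphi [Z [irrZ ltZ]].
have [k Zk] : exists k, ssubset (Z n.+1) (zclosure (fun nu => exists x, nu = phi k x)).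
  have [_ [irr ZX]] := irrZ n.+1 (leqnn _); apply: zirreducible_cover => // [k|mu /ZX/Xphi//].
  exact: zclosed_zclosure.
(* Beyond the end of the chain the chosen function defaults to zero. *)
have /boolp.choice[h hh] : forall m, exists f : struct -> C, polyfun f /\ ((m < n.+1)%N ->
    (forall mu, Z m mu -> f mu = 0) /\ exists2 mu, Z m.+1 mu & f mu != 0).
  move=> m; case: (ltnP m n.+1) => [mn|_]; last by exists (fun=> 0); split; [exact: pf_const|].
  have [cZ _] := irrZ m (ltnW mn); have [_ nZ] := ltZ m mn.
  by have [f [pf f0 fn0]] := ssubset_sep cZ nZ; exists f.
have ph i : polyfun (h i) by have [] := hh i.
have [N [c [[m cm] rel]]] := param_dependent (phid k) ph.
case/eqP: cm; apply: (chain_independent (n := n.+1) (Z := Z) (h := h)) => //.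
- by move=> i /irrZ[_ []].
- by move=> i /ltZ[].
- by move=> i /(hh i).2[].
- by move=> i /(hh i).2[].
move=> mu /Zk; pose f nu := \sum_m c m * mono h m nu.
apply: (zclosure_min (Z := fun nu => f nu = 0)) => [|_ [x ->]]; last exact: rel.
by apply/zclosed_eq/polyfun_sum => p; apply: pf_mul (pf_const _) (polyfun_mono _ _).
Qed.

End Dimension.

(** * Structure constants and the group action *)

(* [Par a l11 .. b22]: e1 e1 = a e1, e1 f_i = sum_j l_ij f_j,
   f_i e1 = sum_j r_ij f_j, f_i f_j = b_ij e1. *)
Record par (K : Type) := Par {
  pa : K; pl11 : K; pl12 : K; pl21 : K; pl22 : K;
  pr11 : K; pr12 : K; pr21 : K; pr22 : K;
  pb11 : K; pb12 : K; pb21 : K; pb22 : K }.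

(** The ring is kept general so that the same formula gives structures over [C] and curves over
    [{poly C}]. *)
Definition mk (K : nzRingType) (P : par K) : idx -> K := fun t => let: (i, j, k) := t in
  match nat_of_ord i, nat_of_ord j, nat_of_ord k with
  | 0%N, 0%N, 0%N => pa P
  | 0%N, 1%N, 1%N => pl11 P | 0%N, 1%N, 2%N => pl12 P
  | 0%N, 2%N, 1%N => pl21 P | 0%N, 2%N, 2%N => pl22 P
  | 1%N, 0%N, 1%N => pr11 P | 1%N, 0%N, 2%N => pr12 P
  | 2%N, 0%N, 1%N => pr21 P | 2%N, 0%N, 2%N => pr22 P
  | 1%N, 1%N, 0%N => pb11 P | 1%N, 2%N, 0%N => pb12 P
  | 2%N, 1%N, 0%N => pb21 P | 2%N, 2%N, 0%N => pb22 P
  | _, _, _ => 0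
  end.

Definition o0 : 'I_3 := ord0.
Definition o1 : 'I_3 := Ordinal (isT : 1 < 3)%N.
Definition o2 : 'I_3 := Ordinal (isT : 2 < 3)%N.

Lemma ord3_ind (P : 'I_3 -> Prop) : P o0 -> P o1 -> P o2 -> forall i, P i.
Proof.
move=> P0 P1 P2 [[|[|[|//]]] lti].
- by rewrite (_ : Ordinal lti = o0) //; apply: val_inj.
- by rewrite (_ : Ordinal lti = o1) //; apply: val_inj.
- by rewrite (_ : Ordinal lti = o2) //; apply: val_inj.
Qed.

Lemma sum3 (V : nmodType) (F : 'I_3 -> V) : \sum_(i < 3) F i = F o0 + F o1 + F o2.
Proof.
rewrite !big_ord_recl big_ord0 addr0 addrA; congr (F _ + F _ + F _); exact: val_inj.
Qed.

Section Structures.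
Variable R : realType.
Local Notation C := (R[i]).
Local Notation struct := (struct R).

Definition coords (mu : struct) : par C :=
  Par (mu (o0, o0, o0)) (mu (o0, o1, o1)) (mu (o0, o1, o2)) (mu (o0, o2, o1)) (mu (o0, o2, o2))
    (mu (o1, o0, o1)) (mu (o1, o0, o2)) (mu (o2, o0, o1)) (mu (o2, o0, o2))
    (mu (o1, o1, o0)) (mu (o1, o2, o0)) (mu (o2, o1, o0)) (mu (o2, o2, o0)).

Lemma is_even_mk (P : par C) : is_even (mk P).
Proof.
by move=> i j k; elim/ord3_ind: i; elim/ord3_ind: j; elim/ord3_ind: k.
Qed.

Lemma mk_coords mu : is_even mu -> mu = mk (coords mu).
Proof.
move=> ev; apply: boolp.funext => -[[i j] k].
by elim/ord3_ind: i; elim/ord3_ind: j; elim/ord3_ind: k => //; apply: ev.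
Qed.

Lemma smul_mk0 (P : par C) x y : smul (mk P) x y o0 =
  pa P * x o0 * y o0 + pb11 P * x o1 * y o1 + pb12 P * x o1 * y o2
  + pb21 P * x o2 * y o1 + pb22 P * x o2 * y o2.
Proof. rewrite /smul !sum3 /=; ring. Qed.

Lemma smul_mk1 (P : par C) x y : smul (mk P) x y o1 =
  x o0 * (y o1 * pl11 P + y o2 * pl21 P) + (x o1 * pr11 P + x o2 * pr21 P) * y o0.
Proof. rewrite /smul !sum3 /=; ring. Qed.

Lemma smul_mk2 (P : par C) x y : smul (mk P) x y o2 =
  x o0 * (y o1 * pl12 P + y o2 * pl22 P) + (x o1 * pr12 P + x o2 * pr22 P) * y o0.
Proof. rewrite /smul !sum3 /=; ring. Qed.

Definition smul_mk := (smul_mk0, smul_mk1, smul_mk2).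

(* The action of the graded automorphism with blocks (c) and (g_ij), where
   [d = c^-1] and (h_ij) is the inverse block. *)
Definition act (c d g11 g12 g21 g22 h11 h12 h21 h22 : C) (P : par C) : par C :=
  let: Par a l11 l12 l21 l22 r11 r12 r21 r22 b11 b12 b21 b22 := P in
  let conj x11 x12 x21 x22 hi1 hi2 gj1 gj2 :=
    d * (hi1 * (x11 * gj1 + x12 * gj2) + hi2 * (x21 * gj1 + x22 * gj2)) in
  let form hi1 hi2 hj1 hj2 :=
    c * (hi1 * (b11 * hj1 + b12 * hj2) + hi2 * (b21 * hj1 + b22 * hj2)) in
  Par (c * d ^+ 2 * a)
    (conj l11 l12 l21 l22 h11 h21 g11 g12) (conj l11 l12 l21 l22 h11 h21 g21 g22)
    (conj l11 l12 l21 l22 h12 h22 g11 g12) (conj l11 l12 l21 l22 h12 h22 g21 g22)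
    (conj r11 r12 r21 r22 h11 h21 g11 g12) (conj r11 r12 r21 r22 h11 h21 g21 g22)
    (conj r11 r12 r21 r22 h12 h22 g11 g12) (conj r11 r12 r21 r22 h12 h22 g21 g22)
    (form h11 h21 h11 h21) (form h11 h21 h12 h22)
    (form h12 h22 h11 h21) (form h12 h22 h12 h22).

Definition gact (c g11 g12 g21 g22 : C) : par C -> par C :=
  let D := g11 * g22 - g12 * g21 in
  act c c^-1 g11 g12 g21 g22 (g22 / D) (- g12 / D) (- g21 / D) (g11 / D).

Definition gmx (c g11 g12 g21 g22 : C) : 'M[C]_3 := \matrix_(i, j)
  match nat_of_ord i, nat_of_ord j with
  | 0%N, 0%N => c | 1%N, 1%N => g11 | 1%N, 2%N => g12 | 2%N, 1%N => g21 | 2%N, 2%N => g22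
  | _, _ => 0
  end.

Lemma mapply_basis (M : 'M[C]_3) i : mapply M (ebasis R i) = fun k => M k i.
Proof.
apply: boolp.funext => k; rewrite /mapply (bigD1 i) //= /ebasis eqxx mulr1 big1 ?addr0 //.
by move=> l /negPf ->; rewrite mulr0.
Qed.

Lemma gmx_mul (c g11 g12 g21 g22 c' h11 h12 h21 h22 : C) :
  gmx c g11 g12 g21 g22 *m gmx c' h11 h12 h21 h22 =
  gmx (c * c') (g11 * h11 + g12 * h21) (g11 * h12 + g12 * h22)
    (g21 * h11 + g22 * h21) (g21 * h12 + g22 * h22).
Proof.
apply/matrixP => i j; rewrite !mxE sum3 !mxE.
by elim/ord3_ind: i; elim/ord3_ind: j => /=; ring.
Qed.

Lemma gmx_inv (c g11 g12 g21 g22 : C) (D := g11 * g22 - g12 * g21) : c != 0 -> D != 0 ->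
  gmx c g11 g12 g21 g22 \in unitmx /\
  invmx (gmx c g11 g12 g21 g22) = gmx c^-1 (g22 / D) (- g12 / D) (- g21 / D) (g11 / D).
Proof.
move=> c0 D0; set g := gmx c _ _ _ _; set h := gmx c^-1 _ _ _ _.
have gh : g *m h = 1%:M.
  rewrite gmx_mul; apply/matrixP => i j; rewrite !mxE.
  by elim/ord3_ind: i; elim/ord3_ind: j => //=; rewrite /D; field; rewrite ?c0 ?D0.
have [ug _] := mulmx1_unit gh; split=> //.
by rewrite -[LHS]mulmx1 -gh mulmxA mulVmx // mul1mx.
Qed.

Lemma sact_gmx (c g11 g12 g21 g22 : C) (P : par C) : c != 0 -> g11 * g22 - g12 * g21 != 0 ->
  sact (gmx c g11 g12 g21 g22) (mk P) = mk (gact c g11 g12 g21 g22 P).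
Proof.
move=> c0 D0; have [_ inv] := gmx_inv c0 D0; rewrite /gact; set D := _ - _ in inv *.
case: P => a l11 l12 l21 l22 r11 r12 r21 r22 b11 b12 b21 b22.
apply: boolp.funext => -[[i j] k]; rewrite /sact inv !mapply_basis /mapply sum3 !smul_mk.
set u := g22 / D; set v := _ / D; set w := _ / D; set z := _ / D; rewrite !mxE.
by elim/ord3_ind: i; elim/ord3_ind: j; elim/ord3_ind: k => /=; ring.
Qed.

Lemma sorbit_mk (P : par C) nu : sorbit (mk P) nu <->
  exists c g11 g12 g21 g22, [/\ c != 0, g11 * g22 - g12 * g21 != 0
    & nu = mk (gact c g11 g12 g21 g22 P)].
Proof.
split=> [[g [[ug eg] ->]]|[c [g11 [g12 [g21 [g22 [c0 D0 ->]]]]]]]; last first.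
  exists (gmx c g11 g12 g21 g22); rewrite sact_gmx //; split=> //; split.
    by have [] := gmx_inv c0 D0.
  by move=> i j; rewrite mxE; elim/ord3_ind: i; elim/ord3_ind: j.
have gE : g = gmx (g o0 o0) (g o1 o1) (g o1 o2) (g o2 o1) (g o2 o2).
  by apply/matrixP => i j; rewrite mxE; elim/ord3_ind: i; elim/ord3_ind: j => //=; apply: eg.
move: (g o0 o0) (g o1 o1) (g o1 o2) (g o2 o1) (g o2 o2) gE => c g11 g12 g21 g22 gE.
suff [c0 D0] : c != 0 /\ g11 * g22 - g12 * g21 != 0.
  by exists c, g11, g12, g21, g22; split=> //; rewrite gE sact_gmx.
split; apply: contraTneq ug => z; rewrite gE.
  have : gmx c g11 g12 g21 g22 *m gmx 1 0 0 0 0 = 0.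
    rewrite gmx_mul z; apply/matrixP => i j; rewrite !mxE.
    by elim/ord3_ind: i; elim/ord3_ind: j => //=; ring.
  move=> e; apply/negP => u; have := congr1 (mulmx (invmx (gmx c g11 g12 g21 g22))) e.
  rewrite mulmxA mulVmx // mul1mx mulmx0 => /matrixP/(_ o0 o0)/eqP.
  by rewrite !mxE oner_eq0.
apply/negP => u.
(* The left factor carries the adjugate of the odd block, so the product vanishes with the
   determinant. Cancelling the invertible factor makes the odd block zero, and the matrix then kills
   the projector onto the odd part. *)
have e : gmx 0 g22 (- g12) (- g21) g11 *m gmx c g11 g12 g21 g22 = 0.
  rewrite gmx_mul; apply/matrixP => i j; rewrite !mxE.
  have {}z : g11 * g22 = g12 * g21 by apply: subr0_eq.
  by elim/ord3_ind: i; elim/ord3_ind: j => //=; ring: z.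
have := congr1 (mulmx^~ (invmx (gmx c g11 g12 g21 g22))) e.
rewrite -mulmxA mulmxV // mulmx1 mul0mx => /matrixP h.
have G : gmx c g11 g12 g21 g22 *m gmx 0 1 0 0 1 = 0.
  apply/matrixP => i j; rewrite gmx_mul.
  move: (h o1 o1) (h o1 o2) (h o2 o1) (h o2 o2); rewrite !mxE /= => -> /eqP + /eqP + ->.
  rewrite !oppr_eq0 => /eqP -> /eqP ->.
  by elim/ord3_ind: i; elim/ord3_ind: j => //=; ring.
have := congr1 (mulmx (invmx (gmx c g11 g12 g21 g22))) G.
rewrite mulmxA mulVmx // mul1mx mulmx0 => /matrixP/(_ o1 o1)/eqP.
by rewrite !mxE oner_eq0.
Qed.
End Structures.

(** * Classification *)

(** Deduces an equation from a known one that is a positive integer multiple of it; the remaining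
    identity is left to [ring]. Linear combinations of known equations are assembled with [eqD] and
    [eqM]. *)
Lemma eq_by_scaling (K : numFieldType) n (x y u v : K) :
  u = v -> n.+1%:R * (x - y) = u - v -> x = y.
Proof.
move=> ->; rewrite subrr => /eqP; rewrite mulf_eq0 pnatr_eq0 /= subr_eq0.
by move=> /eqP.
Qed.

Lemma eqD (K : nzRingType) (x y u v : K) : x = y -> u = v -> x + u = y + v.
Proof. by move=> -> ->. Qed.

Lemma eqM (K : nzRingType) (c x y : K) : x = y -> c * x = c * y.
Proof. by move=> ->. Qed.

(** * The identities as relations between lam, rho and B *)

Section PermEquations.
Variable R : realType.
Local Notation C := (R[i]).
Local Notation struct := (struct R).

(** For fixed vectors each identity is a polynomial equation in the structure constants; the variety
    is the intersection over all choices of vectors. *)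
Lemma zclosed_Var : zclosed (@Var R).
Proof.
have psm (x y : struct -> vec R) : (forall k, polyfun (fun mu => x mu k)) ->
    (forall k, polyfun (fun mu => y mu k)) ->
    forall k, polyfun (fun mu => smul mu (x mu) (y mu) k).
  move=> px py k; rewrite /smul; apply: polyfun_sum => i; apply: polyfun_sum => j.
  by apply: pf_mul; [apply: pf_mul; [exact: px | exact: py] | exact: pf_coord].
have pc (x : vec R) k : polyfun (fun mu : struct => x k) by exact: pf_const.
have psc (s : C) f : polyfun f -> polyfun (fun mu : struct => s * f mu).
  by move=> pf; apply: pf_mul (pf_const _) pf.
have p2 x y k : polyfun (fun mu : struct => smul mu x y k).
  exact: (psm (fun=> x) (fun=> y)).
have pm x y z k : polyfun (fun mu : struct => smul mu (smul mu x y) z k).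
  exact: (psm (fun mu => smul mu x y) (fun=> z)).
have pa x y z k : polyfun (fun mu : struct => associator mu x y z k).
  by apply: polyfun_sub; [exact: pm | exact: (psm (fun=> x) (fun mu => smul mu y z))].
have ceq f g : polyfun f -> polyfun g -> zclosed (fun mu : struct => f mu = g mu).
  move=> pf pg; apply: zclosed_iff (zclosed_eq (polyfun_sub pf pg)) => mu.
  by split=> [/eqP|->]; rewrite ?subrr // subr_eq0 => /eqP.
apply: zclosedI.
  do 4!apply: zclosed_inter => ?.
  exact/zclosed_eq/pf_coord.
do 9!apply: zclosed_inter => ?.
apply: zclosedI; last apply: zclosedI; apply: zclosed_inter => k; apply: ceq => //.
- exact: psc.
- exact: psc.
- by apply: pf_add => //; exact: psc.
- by apply: pf_add; exact: psc.
Qed.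

Implicit Types (P : par C) (f g : C * C).

Definition lam P f : C * C := (f.1 * pl11 P + f.2 * pl21 P, f.1 * pl12 P + f.2 * pl22 P).
Definition rho P f : C * C := (f.1 * pr11 P + f.2 * pr21 P, f.1 * pr12 P + f.2 * pr22 P).
Definition bil P f g : C :=
  f.1 * (pb11 P * g.1 + pb12 P * g.2) + f.2 * (pb21 P * g.1 + pb22 P * g.2).
Definition scal (a : C) f : C * C := (a * f.1, a * f.2).

Definition odd_vec f : vec R := fun k =>
  match nat_of_ord k with 1%N => f.1 | 2%N => f.2 | _ => 0 end.

Lemma homog_odd f : homog (odd_vec f) true.
Proof. by move=> i; elim/ord3_ind: i. Qed.

Lemma homog_even : homog (ebasis R o0) false.
Proof. by move=> i; elim/ord3_ind: i. Qed.

(** The associators of (e1, e1, f) and (f, e1, e1) equal their own negatives, which gives the two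
    squares. The associator of (e1, f, e1) then vanishes too, so lam and rho commute, and the third
    identity on (e1, e1, f) evaluates rho lam. *)
Lemma perm_module P : is_binary_perm (mk P) ->
  forall f, [/\ lam P (lam P f) = scal (pa P) (lam P f),
    rho P (rho P f) = scal (pa P) (rho P f),
    rho P (lam P f) = scal (pa P) (lam P f) & lam P (rho P f) = scal (pa P) (lam P f)].
Proof.
move=> H f.
have [h1 [h2 h3]] := H _ _ _ _ _ _ homog_even homog_even (homog_odd f).
have [k1 _] := H _ _ _ _ _ _ (homog_odd f) homog_even homog_even.
move: (h1 o1) (h1 o2) (h2 o1) (h2 o2) (h3 o1) (h3 o2) (k1 o1) (k1 o2).
rewrite /associator !smul_mk /ebasis /odd_vec /sg /= => a1 a2 a3 a4 a5 a6 a7 a8.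
split; rewrite /lam /rho /scal /=; congr pair.
- by apply: (eq_by_scaling (n := 1) (esym a3)); ring.
- by apply: (eq_by_scaling (n := 1) (esym a4)); ring.
- by apply: (eq_by_scaling (n := 1) a7); ring.
- by apply: (eq_by_scaling (n := 1) a8); ring.
- by apply: (eq_by_scaling (n := 0) (esym a5)); ring.
- by apply: (eq_by_scaling (n := 0) (esym a6)); ring.
- by apply: (eq_by_scaling (n := 1) (eqD a3 (eqM (-2) (eqD a1 a5)))); ring.
- by apply: (eq_by_scaling (n := 1) (eqD a4 (eqM (-2) (eqD a2 a6)))); ring.
Qed.

(** These are the e1 components of identities with one argument e1 and two odd arguments: two on
    (e1, f, g), one on (f, e1, g) and the third identity on (f, g, e1). *)
Lemma perm_form P : is_binary_perm (mk P) -> forall f g,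
  [/\ bil P (lam P f) g - pa P * bil P f g = bil P (lam P g) f - pa P * bil P g f,
      bil P (lam P f) g - pa P * bil P f g = bil P f (lam P g) - bil P (rho P f) g,
      bil P (rho P f) g - bil P f (lam P g) = bil P f (rho P g) - pa P * bil P f g
    & pa P * bil P f g - bil P (lam P g) f = bil P (rho P f) g + bil P (lam P f) g].
Proof.
move=> H f g.
have [h1 [h2 _]] := H _ _ _ _ _ _ homog_even (homog_odd f) (homog_odd g).
have [_ [_ k3]] := H _ _ _ _ _ _ (homog_odd f) (homog_odd g) homog_even.
have [j1 _] := H _ _ _ _ _ _ (homog_odd f) homog_even (homog_odd g).
move: (h1 o0) (h2 o0) (j1 o0) (k3 o0).
rewrite /associator !smul_mk /ebasis /odd_vec /sg /= => a1 a2 a3 a4.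
split; rewrite /lam /rho /bil /=.
- by apply: (eq_by_scaling (n := 0) a1); ring.
- by apply: (eq_by_scaling (n := 0) a2); ring.
- by apply: (eq_by_scaling (n := 0) a3); ring.
- by apply: (eq_by_scaling (n := 0) a4); ring.
Qed.

Lemma perm_odd P : is_binary_perm (mk P) -> forall f g h,
  bil P f g * (lam P h).1 - bil P g h * (rho P f).1
  = bil P f h * (lam P g).1 - bil P h g * (rho P f).1.
Proof.
move=> H f g h.
have [h1 _] := H _ _ _ _ _ _ (homog_odd f) (homog_odd g) (homog_odd h).
move: (h1 o1); rewrite /associator !smul_mk /odd_vec /sg /= => a1.
by rewrite /lam /rho /bil /=; apply: (eq_by_scaling (n := 0) a1); ring.
Qed.
End PermEquations.

(** * Polynomial charts *)

Section Charts.
Variable K : comNzRingType.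

(* lam = p N, rho = q N and B = b w^2, where w = v1 f2^* - v2 f1^* and N = w v. *)
Definition nil_par (v1 v2 p q b : K) : par K :=
  Par 0 (- (p * v1 * v2)) (- (p * v2 ^+ 2)) (p * v1 ^+ 2) (p * v1 * v2)
    (- (q * v1 * v2)) (- (q * v2 ^+ 2)) (q * v1 ^+ 2) (q * v1 * v2)
    (b * v2 ^+ 2) (- (b * v1 * v2)) (- (b * v1 * v2)) (b * v1 ^+ 2).

(* In charts 2, 3 and 4 the rank one operator is f |-> w(f) u with
   u = (x1, x2) and w = (x3, x4); then w(u) is the structure constant a. *)
Definition chart (k : nat) (x1 x2 x3 x4 : K) : par K :=
  let a := x1 * x3 + x2 * x4 in
  match k with
  | 0%N => Par 0 0 0 0 0 0 0 0 0 x1 x2 x3 x4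
  | 1%N => nil_par 1 x1 x2 x3 x4
  | 2%N => Par a 0 0 0 0 (x3 * x1) (x3 * x2) (x4 * x1) (x4 * x2) 0 0 0 0
  | 3%N => Par a (x3 * x1) (x3 * x2) (x4 * x1) (x4 * x2) a 0 0 a 0 0 0 0
  | 4%N => Par a (x3 * x1) (x3 * x2) (x4 * x1) (x4 * x2)
           (x3 * x1) (x3 * x2) (x4 * x1) (x4 * x2) 0 0 0 0
  | 5%N => Par x1 0 0 0 0 0 0 0 0 0 0 0 0
  | 6%N => Par x1 0 0 0 0 x1 0 0 x1 0 0 0 0
  | _ => Par x1 x1 0 0 x1 x1 0 0 x1 0 0 0 0
  end.
End Charts.

(** * Two-by-two matrices and bilinear forms *)

Section Matrices.
Variable F : fieldType.
Implicit Types a m : F.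

(** Both off-diagonal entries are killed by the trace minus [a]. If this factor is nonzero, the
    matrix is diagonal with entries 0 or [a], and the mixed cases are excluded because their trace
    is [a]. *)
Lemma scaled_idempotent2 a m11 m12 m21 m22 : a != 0 ->
  m11 * m11 + m12 * m21 = a * m11 -> m11 * m12 + m12 * m22 = a * m12 ->
  m21 * m11 + m22 * m21 = a * m21 -> m21 * m12 + m22 * m22 = a * m22 ->
  [\/ [/\ m11 = 0, m12 = 0, m21 = 0 & m22 = 0], [/\ m11 = a, m12 = 0, m21 = 0 & m22 = a]
    | m11 + m22 = a /\ m11 * m22 = m12 * m21].
Proof.
move=> a0 e11 e12 e21 e22; have [tr|tr] := eqVneq (m11 + m22) a.
  apply: Or33; split=> //; have -> : m22 = a - m11 by rewrite -tr; ring.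
  by rewrite mulrBr [m11 * a]mulrC -e11; ring.
have tr0 : m11 + m22 - a != 0 by rewrite subr_eq0.
have m120 : m12 = 0.
  apply: (mulfI tr0); rewrite mulr0; transitivity (m11 * m12 + m12 * m22 - a * m12).
    by ring.
  by rewrite e12 subrr.
have m210 : m21 = 0.
  apply: (mulfI tr0); rewrite mulr0; transitivity (m21 * m11 + m22 * m21 - a * m21); first by ring.
  by rewrite e21 subrr.
have diag m : m * m = a * m -> m = 0 \/ m = a.
  move=> e; have /eqP : m * (m - a) = 0 by rewrite mulrBr e mulrC subrr.
  by rewrite mulf_eq0 subr_eq0 => /orP[]/eqP; [left | right].
move: e11 e22 tr; rewrite m120 m210 !mul0r addr0 add0r => /diag[]-> /diag[]->;
  rewrite ?addr0 ?add0r ?eqxx // => _; [exact: Or31 | exact: Or32].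
Qed.

Lemma rank1_2 m11 m12 m21 m22 : m11 * m22 = m12 * m21 ->
  exists u1 u2 o1 o2, [/\ m11 = o1 * u1, m12 = o1 * u2, m21 = o2 * u1 & m22 = o2 * u2].
Proof.
move=> det; have [m0|m0] := eqVneq m11 0; last first.
  by exists m11, m12, 1, (m21 / m11); split; rewrite ?mul1r // -?mulrA ?mulVf ?mulr1 //;
    apply: (mulfI m0); rewrite det; field.
have [m0'|m0'] := eqVneq m12 0; first by exists m21, m22, 0, 1; rewrite m0 m0' !mul0r !mul1r.
exists m11, m12, 1, (m22 / m12); split; rewrite ?mul1r ?mulfVK //.
by apply: (mulfI m0'); rewrite -det m0; ring.
Qed.

(** The unknowns stand for B(v, f) and B(f, v). In the exceptional case [q = - 2 p] the first
    equation gives [k' = - k] and the second becomes [3 p k = 0]. *)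
Lemma nil_form_eq0 (p q k k' : F) : (2 : F) != 0 -> (3 : F) != 0 -> (p != 0) || (q != 0) ->
  (p + q) * k = p * k' -> q * k = (p + q) * k' -> (2 * p + q) * k = 0 -> k = 0 /\ k' = 0.
Proof.
move=> n2 n3 pq e1 e2 /eqP; rewrite mulf_eq0 => /orP[]/eqP e3; last first.
  split=> //; move: e1 e2; rewrite e3 !mulr0 => /esym/eqP e1 /esym/eqP e2.
  apply/eqP; move: e1 e2; rewrite !mulf_eq0; case: (k' == 0) => //; rewrite !orbF => /eqP p0.
  by move: pq; rewrite p0 add0r eqxx /= => /negPf->.
have qE : q = - (2 * p) by rewrite -[LHS]subr0 -e3; ring.
have p0 : p != 0.
  by apply: contraTneq pq => p0; rewrite qE p0 mulr0 oppr0 eqxx.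
have kk : k' = - k by apply: (mulfI p0); rewrite -e1 qE; ring.
have k0 : k = 0.
  apply: (mulfI (mulf_neq0 n3 p0)); rewrite mulr0.
  transitivity ((p + q) * k' - q * k); last by rewrite e2 subrr.
  by rewrite kk qE; ring.
by rewrite kk k0 oppr0.
Qed.

(** Adding the two identities gives B(lam f, g) + B(f, rho g) = 2 a B(f, g). Evaluated at (lam f, g)
    and at (f, rho g), this shows that both summands equal B(lam f, rho g) / a, so each is a B(f,
    g). *)
Lemma module_form (V : Type) (lam rho : V -> V) (B : V -> V -> F) a : (2 : F) != 0 -> a != 0 ->
  (forall f g, [/\ B (lam (lam f)) g = a * B (lam f) g, B (lam (rho f)) g = a * B (lam f) g
    & B f (rho (rho g)) = a * B f (rho g)]) ->
  (forall f g, B (lam f) g - a * B f g = B f (lam g) - B (rho f) g) ->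
  (forall f g, B (rho f) g - B f (lam g) = B f (rho g) - a * B f g) ->
  forall f g, B (lam f) g = a * B f g /\ B (rho f) g = a * B f g.
Proof.
move=> n2 a0 hyp e1 e2.
have S f g : B (lam f) g + B f (rho g) = 2 * (a * B f g).
  transitivity (B (lam f) g - a * B f g + (B f (rho g) - a * B f g) + 2 * (a * B f g)).
    by ring.
  by rewrite e1 -e2; ring.
have lamrho f g : B (lam f) g = B f (rho g).
  have [h1 _ h3] := hyp f g; have := S (lam f) g; have := S f (rho g).
  rewrite h1 h3 => s1 s2; apply: (mulfI a0).
  have -> : a * B (lam f) g = B (lam f) (rho g).
    apply: (addrI (a * B (lam f) g)); rewrite s2; ring.
  by apply: (addIr (a * B f (rho g))); rewrite s1; ring.
have lamE f g : B (lam f) g = a * B f g.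
  by apply: (mulfI n2); rewrite -S -lamrho; ring.
move=> f g; split=> //; apply: (mulfI a0).
by have [_ + _] := hyp f g; rewrite !lamE.
Qed.
End Matrices.

Section Classification.
Variable R : realType.
Local Notation C := (R[i]).
Local Notation struct := (struct R).
Implicit Types P : par C.

Lemma natC_neq0 n : (n.+1%:R : C) != 0.
Proof. by rewrite pnatr_eq0. Qed.

(** By [module_form] both operators act on the left argument of B as the scalar a. The last identity
    of [perm_form] then makes B skew, and [perm_odd] on (f1, f2, f1) gives 3 a b12 = 0. *)
Lemma perm_form0 P : is_binary_perm (mk P) -> pa P != 0 ->
  [/\ pb11 P = 0, pb12 P = 0, pb21 P = 0 & pb22 P = 0].
Proof.
move=> H a0; pose a := pa P.
have bilZl c f g : bil P (scal c f) g = c * bil P f g by rewrite /bil /scal /=; ring.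
have bilZr c f g : bil P f (scal c g) = c * bil P f g by rewrite /bil /scal /=; ring.
have M f g : bil P (lam P f) g = a * bil P f g /\ bil P (rho P f) g = a * bil P f g.
  apply: (module_form (natC_neq0 1) a0) f g => f g.
  - have [ll _ _ lr] := perm_module H f; have [_ rr _ _] := perm_module H g.
    by rewrite ll lr rr !bilZl bilZr.
  - by have [] := perm_form H f g.
  - by have [] := perm_form H f g.
have skew f g : bil P f g = - bil P g f.
  have [_ _ _ e] := perm_form H f g; have [lf rf] := M f g; have [lg _] := M g f.
  apply: (mulfI a0); apply: (eq_by_scaling (n := 0) (esym e)).
  by rewrite lf rf lg /a; ring.
have b11 : pb11 P = 0.
  by apply: (eq_by_scaling (n := 1) (skew (1, 0) (1, 0))); rewrite /bil /=; ring.
have b22 : pb22 P = 0.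
  by apply: (eq_by_scaling (n := 1) (skew (0, 1) (0, 1))); rewrite /bil /=; ring.
have b21 : pb21 P = - pb12 P.
  by apply: (eq_by_scaling (n := 0) (skew (0, 1) (1, 0))); rewrite /bil /=; ring.
suff b12 : pb12 P = 0 by rewrite b21 b12 oppr0.
have := perm_odd H (1, 0) (0, 1) (1, 0).
have [l _] := M (1, 0) (0, 1); have [_ r] := M (1, 0) (0, 1).
move: l r; rewrite /bil /lam /rho /= b11 b22 b21 => l r e.
have a12 : a * pb12 P = 0.
  apply: (eq_by_scaling (n := 2) (eqD e (eqM (-1) (eqD l (eqM 2 r))))).
  by rewrite /a; ring.
by apply: (mulfI a0); rewrite mulr0.
Qed.

(** The four products have one shape: each is a lam unless both factors are rho, whence the boolean
    disjunction. *)
Lemma perm_entries P : is_binary_perm (mk P) -> forall i j : bool,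
  let L := if i then lam P else rho P in let M := if j then lam P else rho P in
  let LM := if i || j then lam P else rho P in
  [/\ (M (L (1, 0))).1 = pa P * (LM (1, 0)).1, (M (L (1, 0))).2 = pa P * (LM (1, 0)).2,
    (M (L (0, 1))).1 = pa P * (LM (0, 1)).1 & (M (L (0, 1))).2 = pa P * (LM (0, 1)).2].
Proof.
move=> H i j /=; have [a b c d] := perm_module H (1, 0).
have [a' b' c' d'] := perm_module H (0, 1).
case: i; case: j; split.
all: by [exact: (f_equal fst a) | exact: (f_equal snd a)
  | exact: (f_equal fst a') | exact: (f_equal snd a')
  | exact: (f_equal fst b) | exact: (f_equal snd b)
  | exact: (f_equal fst b') | exact: (f_equal snd b')
  | exact: (f_equal fst c) | exact: (f_equal snd c)
  | exact: (f_equal fst c') | exact: (f_equal snd c')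
  | exact: (f_equal fst d) | exact: (f_equal snd d)
  | exact: (f_equal fst d') | exact: (f_equal snd d')].
Qed.

(** Each operator is 0, the scalar a, or of rank one with trace a. For lam = 0 every choice of rho
    is possible; lam = a forces rho = a; a rank one lam leaves rho = a or rho = lam. *)
Lemma perm_chart_unit P : is_binary_perm (mk P) -> pa P != 0 ->
  exists2 k, (2 <= k < 8)%N & exists x1 x2 x3 x4, P = chart k x1 x2 x3 x4.
Proof.
move=> H a0; have [b11 b12 b21 b22] := perm_form0 H a0.
have [ll1 ll2 ll3 ll4] := perm_entries H true true.
have [lr1 lr2 lr3 lr4] := perm_entries H true false.
have [rl1 rl2 rl3 rl4] := perm_entries H false true.
have [rr1 rr2 rr3 rr4] := perm_entries H false false.
case: P H a0 b11 b12 b21 b22 ll1 ll2 ll3 ll4 lr1 lr2 lr3 lr4 rl1 rl2 rl3 rl4 rr1 rr2 rr3 rr4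
  => a l11 l12 l21 l22 r11 r12 r21 r22 b11 b12 b21 b22 _ /= a0 -> -> -> ->.
rewrite /lam /rho /= !(mul1r, mul0r, addr0, add0r).
move=> ll1 ll2 ll3 ll4 lr1 lr2 lr3 lr4 rl1 rl2 rl3 rl4 rr1 rr2 rr3 rr4.
have [[L1 L2 L3 L4]|[L1 L2 L3 L4]|[trL detL]] := scaled_idempotent2 a0 ll1 ll2 ll3 ll4.
- have [[M1 M2 M3 M4]|[M1 M2 M3 M4]|[trM detM]] := scaled_idempotent2 a0 rr1 rr2 rr3 rr4.
  + by exists 5%N => //; exists a, 0, 0, 0; rewrite /= L1 L2 L3 L4 M1 M2 M3 M4.
  + by exists 6%N => //; exists a, 0, 0, 0; rewrite /= L1 L2 L3 L4 M1 M2 M3 M4.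
  + exists 2%N => //; have [u1 [u2 [v1 [v2 [m1 m2 m3 m4]]]]] := rank1_2 detM.
    exists u1, u2, v1, v2; rewrite /= L1 L2 L3 L4 -trM m1 m2 m3 m4.
    by congr Par; ring.
- exists 7%N => //; exists a, 0, 0, 0; move: lr1 lr2 lr3 lr4; rewrite /= L1 L2 L3 L4.
  rewrite !(mul0r, mulr0, addr0, add0r) => /(mulfI a0) -> /eqP + /eqP + /(mulfI a0) ->.
  by rewrite !mulf_eq0 (negPf a0) /= => /eqP -> /eqP ->.
have [u1 [u2 [v1 [v2 [m1 m2 m3 m4]]]]] := rank1_2 detL.
have [[M1 M2 M3 M4]|[M1 M2 M3 M4]|[trM detM]] := scaled_idempotent2 a0 rr1 rr2 rr3 rr4.
- move: lr1 lr4; rewrite M1 M2 M3 M4 !(mul0r, mulr0, addr0) => /esym/eqP + /esym/eqP.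
  rewrite !mulf_eq0 (negPf a0) /= => /eqP l110 /eqP l220.
  by move: a0; rewrite -trL l110 l220 addr0 eqxx.
- exists 3%N => //; exists u1, u2, v1, v2; rewrite /= M1 M2 M3 M4 -trL m1 m2 m3 m4.
  by congr Par; ring.
exists 4%N => //; exists u1, u2, v1, v2.
(* The difference X = rho - lam satisfies X^2 = a X and has trace 0, whereas the nonzero
   alternatives have trace 2 a or a. *)
suff [-> -> -> ->] : [/\ r11 = l11, r12 = l12, r21 = l21 & r22 = l22].
  by rewrite /= -trL m1 m2 m3 m4; congr Par; ring.
have eqB (x y z t : C) : x = y -> z = t -> x - z = y - t by move=> -> ->.
have [] := @scaled_idempotent2 _ a (r11 - l11) (r12 - l12) (r21 - l21) (r22 - l22) a0.
- by apply: (eq_by_scaling (n := 0) (eqB _ _ _ _ (eqD rr1 ll1) (eqD rl1 lr1))); ring.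
- by apply: (eq_by_scaling (n := 0) (eqB _ _ _ _ (eqD rr2 ll2) (eqD rl2 lr2))); ring.
- by apply: (eq_by_scaling (n := 0) (eqB _ _ _ _ (eqD rr3 ll3) (eqD rl3 lr3))); ring.
- by apply: (eq_by_scaling (n := 0) (eqB _ _ _ _ (eqD rr4 ll4) (eqD rl4 lr4))); ring.
- by case=> /subr0_eq -> /subr0_eq -> /subr0_eq -> /subr0_eq ->.
- case=> d1 _ _ d4; case/eqP: a0; apply: (eq_by_scaling (n := 1) (eqB _ _ _ _ trM trL)).
  transitivity (a + a); first by ring.
  by rewrite -{1}d1 -d4; ring.
case=> d _; case/eqP: a0; apply: (eq_by_scaling (n := 0) (esym (eqB _ _ _ _ d (eqB _ _ _ _ trM
  trL)))).
by ring.
Qed.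

Lemma nilpotent2 (m11 m12 m21 m22 : C) :
  m11 * m11 + m12 * m21 = 0 -> m11 * m12 + m12 * m22 = 0 ->
  m21 * m11 + m22 * m21 = 0 -> m21 * m12 + m22 * m22 = 0 ->
  m11 = - m22.
Proof.
move=> e11 e12 e21 e22; apply/eqP; rewrite -addr_eq0; apply/negPn/negP => tr0.
have m12_0 : m12 = 0 by apply: (mulfI tr0); rewrite mulr0 -e12; ring.
have m21_0 : m21 = 0 by apply: (mulfI tr0); rewrite mulr0 -e21; ring.
move: e11 e22 tr0; rewrite m12_0 m21_0 !mul0r addr0 add0r.
by move=> /eqP + /eqP; rewrite !mulf_eq0 !orbb => /eqP -> /eqP ->; rewrite addr0 eqxx.
Qed.

(** The vector v = (1, t) spans both kernel and image of lam, and rho lam = 0 makes rho a multiple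
    of lam. The factors [1] keep the entries in the shape required with [v1 = 1]. *)
Lemma nilpotent_pair2 (l11 l12 l21 l22 r11 r12 r21 r22 : C) :
  l11 = - l22 -> r11 = - r22 -> l21 * l12 + l22 * l22 = 0 -> r21 * r12 + r22 * r22 = 0 ->
  l21 * r11 + l22 * r21 = 0 -> l21 * r12 + l22 * r22 = 0 -> l21 != 0 ->
  exists t p q,
    [/\ l11 = - (p * 1 * t), l12 = - (p * t ^+ 2), l21 = p * 1 ^+ 2 & l22 = p * 1 * t] /\
    [/\ r11 = - (q * 1 * t), r12 = - (q * t ^+ 2), r21 = q * 1 ^+ 2 & r22 = q * 1 * t].
Proof.
move=> l1 r1 l3 r3 e1 e2 n0; exists (l22 / l21), l21, r21.
have r22E : r22 = r21 * 1 * (l22 / l21).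
  apply: (mulfI n0); transitivity (l22 * r21 - (l21 * r11 + l22 * r21)).
    by rewrite r1; ring.
  by rewrite e1; field.
split; split; rewrite ?expr1n ?mulr1 //.
- by rewrite l1; congr (- _); field.
- apply: (mulfI n0); transitivity (l21 * l12 + l22 * l22 - l22 * l22); first by ring.
  by rewrite l3; field.
- by field.
- by rewrite r1 r22E mulr1.
- apply: (mulfI n0); transitivity (l21 * r12 + l22 * r22 - l22 * r22); first by ring.
  by rewrite e2 r22E; field.
- by rewrite r22E mulr1.
Qed.

(* Since lam^2 = rho^2 = lam rho = rho lam = 0, both operators are multiples of
   the same nilpotent; its kernel is spanned by (0, 1) unless l21 or r21 is nonzero. *)
Lemma perm_nil_common P : is_binary_perm (mk P) -> pa P = 0 ->
  exists v1 v2 p q,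
  P = Par 0 (- (p * v1 * v2)) (- (p * v2 ^+ 2)) (p * v1 ^+ 2) (p * v1 * v2)
    (- (q * v1 * v2)) (- (q * v2 ^+ 2)) (q * v1 ^+ 2) (q * v1 * v2)
    (pb11 P) (pb12 P) (pb21 P) (pb22 P) /\ (v1 = 1 \/ v1 = 0 /\ v2 = 1).
Proof.
move=> H a0.
have [ll1 ll2 ll3 ll4] := perm_entries H true true.
have [lr1 lr2 lr3 lr4] := perm_entries H true false.
have [rl1 rl2 rl3 rl4] := perm_entries H false true.
have [rr1 rr2 rr3 rr4] := perm_entries H false false.
case: P H a0 ll1 ll2 ll3 ll4 lr1 lr2 lr3 lr4 rl1 rl2 rl3 rl4 rr1 rr2 rr3 rr4
  => a l11 l12 l21 l22 r11 r12 r21 r22 b11 b12 b21 b22 _ /= ->.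
rewrite /lam /rho /= !(mul1r, mul0r, addr0, add0r).
move=> ll1 ll2 ll3 ll4 lr1 lr2 lr3 lr4 rl1 rl2 rl3 rl4 rr1 rr2 rr3 rr4.
have l1 := nilpotent2 ll1 ll2 ll3 ll4; have r1 := nilpotent2 rr1 rr2 rr3 rr4.
have [l21_0|l21_0] := eqVneq l21 0; last first.
  have [t [p [q [[-> -> -> ->] [-> -> -> ->]]]]] := nilpotent_pair2 l1 r1 ll4 rr4 lr3 lr4 l21_0.
  by exists 1, t, p, q; split=> //; left.
have [r21_0|r21_0] := eqVneq r21 0; last first.
  have [t [q [p [[-> -> -> ->] [-> -> -> ->]]]]] := nilpotent_pair2 r1 l1 rr4 ll4 rl3 rl4 r21_0.
  by exists 1, t, p, q; split=> //; left.
exists 0, 1, (- l12), (- r12); split; last by right.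
move: ll4 rr4; rewrite l1 r1 l21_0 r21_0 !mul0r !add0r => /eqP + /eqP.
by rewrite !mulf_eq0 !orbb => /eqP -> /eqP ->; congr Par; ring.
Qed.

(** Evaluating [perm_form] at (f, v) gives B(v, v) = 0; at (f, f) it gives the linear system of
    [nil_form_eq0]. *)
Lemma perm_nil_form P (p q : C) v f : is_binary_perm (mk P) -> pa P = 0 -> (p != 0) || (q != 0) ->
  lam P v = (0, 0) -> rho P v = (0, 0) -> lam P f = scal p v -> rho P f = scal q v ->
  [/\ bil P v v = 0, bil P v f = 0 & bil P f v = 0].
Proof.
move=> H a0 pq lv rv lf rf.
have bilZl c g h : bil P (scal c g) h = c * bil P g h by rewrite /bil /scal /=; ring.
have bilZr c g h : bil P g (scal c h) = c * bil P g h by rewrite /bil /scal /=; ring.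
have bil0l g : bil P (0, 0) g = 0 by rewrite /bil /=; ring.
have bil0r g : bil P g (0, 0) = 0 by rewrite /bil /=; ring.
have [_ e1 e2 e3] := perm_form H f v; move: e1 e2 e3.
rewrite a0 lf rf lv rv !bilZl ?bilZr ?bil0l ?bil0r !mul0r !subr0 sub0r => e1 e2 _.
have vv : bil P v v = 0.
  apply/eqP; move: e2; rewrite ?subr0 => /eqP; rewrite mulf_eq0 => /orP[/eqP q0|//].
  by move: e1 pq => /eqP; rewrite q0 mul0r oppr0 mulf_eq0 eqxx orbF => /orP[->|].
have [_ e4 e5 e6] := perm_form H f f; move: e4 e5 e6.
rewrite a0 lf rf !bilZl !bilZr !mul0r !subr0 sub0r => e4 e5 e6.
have [||| k k'] := @nil_form_eq0 _ p q (bil P v f) (bil P f v) (natC_neq0 1) (natC_neq0 2) pq.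
- by apply: (eq_by_scaling (n := 0) e4); ring.
- by apply: (eq_by_scaling (n := 0) e5); ring.
- by apply: (eq_by_scaling (n := 0) (esym e6)); ring.
by split.
Qed.

Lemma perm_chart_nil P : is_binary_perm (mk P) -> pa P = 0 ->
  (exists x1 x2 x3 x4, P = chart 0 x1 x2 x3 x4) \/
  (exists v1 v2 p q b, P = nil_par v1 v2 p q b).
Proof.
move=> H a0; have [v1 [v2 [p [q [PE v12]]]]] := perm_nil_common H a0.
have [pq|] := boolP ((p != 0) || (q != 0)); last first.
  rewrite negb_or !negbK => /andP[/eqP p0 /eqP q0]; left.
  exists (pb11 P), (pb12 P), (pb21 P), (pb22 P).
  by rewrite {1}PE p0 q0 /=; congr Par; ring.
right; case: P H a0 PE => a l11 l12 l21 l22 r11 r12 r21 r22 b11 b12 b21 b22 H _ /= PE.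
case: PE H => -> -> -> -> -> -> -> -> -> H.
have nf f := @perm_nil_form _ p q (v1, v2) f H (erefl _) pq.
(* A vector that N sends to v is (0, 1) when v = (1, v2), and (-1, 0) when v = (0, 1). *)
case: v12 => [v1E|[v1E v2E]].
  have [||||] := nf (0, 1); rewrite ?/lam ?/rho ?/scal /=; try by congr pair; rewrite v1E; ring.
  rewrite /bil /= v1E => vv vf fv; exists 1, v2, p, q, b22; congr Par => //.
  - by apply: (eq_by_scaling (n := 0) (eqD vv (eqM (- v2) (eqD vf fv)))); ring.
  - by apply: (eq_by_scaling (n := 0) vf); ring.
  - by apply: (eq_by_scaling (n := 0) fv); ring.
  - by ring.
have [||||] := nf (- 1, 0); rewrite ?/lam ?/rho ?/scal /=; try by congr pair; rewrite v1E v2E; ring.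
rewrite /bil /= v1E v2E => vv vf fv; exists 0, 1, p, q, b11; congr Par => //.
- by ring.
- by apply: (eq_by_scaling (n := 0) (esym fv)); ring.
- by apply: (eq_by_scaling (n := 0) (esym vf)); ring.
- by apply: (eq_by_scaling (n := 0) vv); ring.
Qed.

Lemma Var_chart (mu : struct) : Var mu ->
  (exists2 k, (k < 8)%N & exists x1 x2 x3 x4, mu = mk (chart k x1 x2 x3 x4)) \/
  (exists v1 v2 p q b, mu = mk (nil_par v1 v2 p q b)).
Proof.
case=> /mk_coords ->; set P := coords mu => H.
have [a0|a0] := eqVneq (pa P) 0.
  have [[x1 [x2 [x3 [x4 ->]]]]|[v1 [v2 [p [q [b ->]]]]]] := perm_chart_nil H a0.
    by left; exists 0%N => //; exists x1, x2, x3, x4.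
  by right; exists v1, v2, p, q, b.
have [k /andP[_ k8] [x1 [x2 [x3 [x4 ->]]]]] := perm_chart_unit H a0.
by left; exists k => //; exists x1, x2, x3, x4.
Qed.

End Classification.

(** * The charts satisfy the identities *)

Section ChartsInVar.
Variable R : realType.
Local Notation C := (R[i]).
Local Notation struct := (struct R).
Implicit Types P : par C.

Definition even_vec (s : C) : vec R := fun k =>
  match nat_of_ord k with 0%N => s | _ => 0 end.

Lemma homogE (x : vec R) d : homog x d ->
  x = if d then odd_vec (x o1, x o2) else even_vec (x o0).
Proof.
move=> h; apply: boolp.funext => i.
by case: d h => h; elim/ord3_ind: i => //; apply: h.
Qed.

Ltac perm_identities :=
  split; [exact: is_even_mk |
    let x := fresh in let y := fresh in let z := fresh in
    move=> x y z [] [] [] /homogE-> /homogE-> /homogE->;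
    split; [|split| |split| |split| |split| |split| |split| |split| |split];
    elim/ord3_ind; rewrite /associator !smul_mk /odd_vec /even_vec /sg /=; ring].

Lemma nil_Var (v1 v2 p q b : C) : Var (mk (nil_par v1 v2 p q b)).
Proof. perm_identities. Qed.

(** Converse of [perm_module] for B = 0: a triple product with one odd argument f reduces to a
    multiple of lam f or rho f, and one with more odd arguments vanishes. *)
Lemma Var_of_module P : pb11 P = 0 -> pb12 P = 0 -> pb21 P = 0 -> pb22 P = 0 ->
  (forall f, [/\ lam P (lam P f) = scal (pa P) (lam P f),
    rho P (rho P f) = scal (pa P) (rho P f),
    rho P (lam P f) = scal (pa P) (lam P f) & lam P (rho P f) = scal (pa P) (lam P f)]) ->
  Var (mk P).
Proof.
move=> b11 b12 b21 b22 H; split; first exact: is_even_mk.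
have ee s t : smul (mk P) (even_vec s) (even_vec t) = even_vec (pa P * (s * t)).
  apply: boolp.funext; elim/ord3_ind; rewrite smul_mk /even_vec /=; ring.
have eo s f : smul (mk P) (even_vec s) (odd_vec f) = odd_vec (scal s (lam P f)).
  apply: boolp.funext; elim/ord3_ind; rewrite smul_mk /even_vec /odd_vec /=; ring.
have oe s f : smul (mk P) (odd_vec f) (even_vec s) = odd_vec (scal s (rho P f)).
  apply: boolp.funext; elim/ord3_ind; rewrite smul_mk /even_vec /odd_vec /=; ring.
have oo f g : smul (mk P) (odd_vec f) (odd_vec g) = even_vec 0.
  by apply: boolp.funext; elim/ord3_ind; rewrite smul_mk ?b11 ?b12 ?b21 ?b22 /even_vec /odd_vec
    /=; ring.
have lamZ s f : lam P (scal s f) = scal s (lam P f) by rewrite /lam /scal /=; congr pair; ring.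
have rhoZ s f : rho P (scal s f) = scal s (rho P f) by rewrite /rho /scal /=; congr pair; ring.
have ll f : lam P (lam P f) = scal (pa P) (lam P f) by have [] := H f.
have rr f : rho P (rho P f) = scal (pa P) (rho P f) by have [] := H f.
have rl f : rho P (lam P f) = scal (pa P) (lam P f) by have [] := H f.
have lr f : lam P (rho P f) = scal (pa P) (lam P f) by have [] := H f.
move=> x y z [] [] [] /homogE-> /homogE-> /homogE->; (split; last split) => k;
  rewrite /associator !(ee, eo, oe, oo) ?(lamZ, rhoZ) ?(ll, rr, rl, lr);
  elim/ord3_ind: k; rewrite /odd_vec /even_vec /scal /sg [nat_of_ord _]/=;
    cbn [fst snd addb andb]; ring.
Qed.

Lemma chart_Var k (x1 x2 x3 x4 : C) : Var (mk (chart k x1 x2 x3 x4)).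
Proof.
case: k => [|[|k]]; [perm_identities | exact: nil_Var | ].
by apply: Var_of_module => [||||f]; case: k => [|[|[|[|[|k]]]]] //=;
  rewrite /lam /rho /scal /=; split; congr pair; ring.
Qed.
End ChartsInVar.

(** * Orbits *)

Section Orbits.
Variable R : realType.
Local Notation C := (R[i]).
Local Notation struct := (struct R).
Implicit Types P : par C.

(** Representatives in the order of [comp8]. In case 1, v = (0, 1) makes the entries [- p] and
    [- q], which explains the signs. *)
Definition base (k : nat) (a : C) : par C :=
  match k with
  | 0%N => chart 0 0 (a + 1) (a - 1) 0
  | 1%N => nil_par 0 1 (- (1 + a)) (- (1 - a)) 1
  | _ => chart k 1 0 1 0
  end.

Definition orb k : struct -> Prop := fun nu => exists a, sorbit (mk (base k a)) nu.

(** Index 1 is excluded because its orbits contain points with [v1 = 0], such as [base 1 a], that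
    lie outside [chart 1]. *)
Lemma orb_chart k nu : k != 1%N -> orb k nu -> exists x1 x2 x3 x4, nu = mk (chart k x1 x2 x3 x4).
Proof.
move=> k1 [a /sorbit_mk[c [g11 [g12 [g21 [g22 [c0 D0 ->]]]]]]].
pose D := g11 * g22 - g12 * g21.
case: k k1 => [_|[//|[|[|[|[|[|k]]]]] _]].
- exists (pb11 (gact c g11 g12 g21 g22 (base 0 a))), (pb12 (gact c g11 g12 g21 g22 (base 0 a))),
    (pb21 (gact c g11 g12 g21 g22 (base 0 a))), (pb22 (gact c g11 g12 g21 g22 (base 0 a))).
  congr mk; rewrite /gact /act /base /chart /=; congr Par; field; rewrite ?c0 ?D0 //.
(* The vector u is transformed by g and rescaled by 1 / c; the covector w is transformed by the
   inverse of g. *)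
- exists (g11 / c), (g21 / c), (g22 / D), (- g12 / D).
  congr mk; rewrite /D /gact /act /base /chart /=; congr Par; field; rewrite ?c0 ?D0 //.
- exists (g11 / c), (g21 / c), (g22 / D), (- g12 / D).
  congr mk; rewrite /D /gact /act /base /chart /=; congr Par; field; rewrite ?c0 ?D0 //.
- exists (g11 / c), (g21 / c), (g22 / D), (- g12 / D).
  congr mk; rewrite /D /gact /act /base /chart /=; congr Par; field; rewrite ?c0 ?D0 //.
all: exists c^-1, 0, 0, 0; congr mk; rewrite /gact /act /base /chart /=; congr Par; field;
  rewrite ?c0 ?D0 //.
Qed.

Lemma orb_nil nu : orb 1 nu -> exists v1 v2 p q b, nu = mk (nil_par v1 v2 p q b).
Proof.
move=> [a /sorbit_mk[c [g11 [g12 [g21 [g22 [c0 D0 ->]]]]]]].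
pose D := g11 * g22 - g12 * g21.
exists g12, g22, (- (1 + a) / (c * D)), (- (1 - a) / (c * D)), (c / D ^+ 2).
congr mk; rewrite /D /gact /act /base /nil_par /=; congr Par; field; rewrite ?c0 ?D0 //.
Qed.

(** Its nonvanishing marks generic points. For [k = 0] the last two factors are the skew part of the
    form and the discriminant of its symmetric part; for [k = 1] they are p + q and b, both nonzero
    on [R07]. *)
Definition chart_den (K : comNzRingType) k (x1 x2 x3 x4 : K) : K :=
  match k with
  | 0%N => x1 * ((x2 - x3) * ((x2 + x3) ^+ 2 - 4 * x1 * x4))
  | 1%N => (x2 + x3) * x4
  | 2%N | 3%N | 4%N => x1 * x3 + x2 * x4
  | _ => x1
  end.

Lemma chart_orb k (x1 x2 x3 x4 : C) :
  chart_den k x1 x2 x3 x4 != 0 -> orb k (mk (chart k x1 x2 x3 x4)).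
Proof.
have two0 : (2 : C) != 0 by rewrite pnatr_eq0.
case: k => [|[|k]] /=.
- rewrite !mulf_eq0 !negb_or => /and3P[x10 P0 disc0].
  (* Here [s] and [P] are the symmetric and skew halves of the off-diagonal entries, and [d] is a
     square root of the discriminant. The parameter of the family is [d / P] up to sign. *)
  pose s := (x2 + x3) / 2; pose P := (x2 - x3) / 2; pose d := sqrtC (s ^+ 2 - x1 * x4).
  have dd : d ^+ 2 = s ^+ 2 - x1 * x4 by rewrite sqrtCK.
  have d0 : d != 0.
    apply: contraNneq disc0 => d0; move: dd; rewrite d0 expr0n /= => e.
    apply/eqP; transitivity (4 * (s ^+ 2 - x1 * x4)); last by rewrite -e mulr0.
    by rewrite /s; field.
  have {}P0 : P != 0 by rewrite mulf_neq0 ?invr_neq0.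
  have -> : x4 = (s ^+ 2 - d ^+ 2) / x1 by rewrite dd; field.
  have -> : x2 = s + P by rewrite /s /P; field.
  have -> : x3 = s - P by rewrite /s /P; field.
  move: s P d d0 P0 {dd disc0} => s P d d0 P0.
  exists (- d / P); apply/sorbit_mk.
  (* The columns (- s + d, x1) and (- s - d, x1) span the isotropic lines of the symmetric part. *)
  exists (2 * P * d * x1), (- s + d), (- s - d), x1, x1.
  have e : (- s + d) * x1 - (- s - d) * x1 = 2 * d * x1 by ring.
  split; rewrite ?e ?mulf_neq0 //.
  congr mk; rewrite /gact e /act /base /chart /=; congr Par; field; rewrite ?x10 ?d0 ?P0 //.
- rewrite mulf_eq0 negb_or => /andP[pq0 b0].
  exists ((x2 - x3) / (x2 + x3)); apply/sorbit_mk.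
  exists x4, 0, (x4 * (x2 + x3) / 2), 1, (x4 * (x2 + x3) / 2 * x1).
  have e : 0 * (x4 * (x2 + x3) / 2 * x1) - x4 * (x2 + x3) / 2 * 1 = - (x4 * (x2 + x3)) / 2 by field.
  split; rewrite ?e ?mulf_neq0 ?oppr_eq0 ?mulf_neq0 ?invr_neq0 //.
  congr mk; rewrite /gact e /act /base /nil_par /=; congr Par; field; rewrite ?b0 ?pq0 //.
have rank1 : x1 * x3 + x2 * x4 != 0 -> (k.+2 < 5)%N -> orb k.+2 (mk (chart k.+2 x1 x2 x3 x4)).
  move=> a0 j5; exists 0; apply/sorbit_mk; exists (x1 * x3 + x2 * x4)^-1, x1, (- x4), x2, x3.
  have e : x1 * x3 - - x4 * x2 = x1 * x3 + x2 * x4 by ring.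
  split; rewrite ?e ?invr_neq0 //; congr mk.
  rewrite /gact e /base; case: k j5 => [|[|[|//]]] _; rewrite /chart /act /=; congr Par; field;
    rewrite ?a0 //.
have scalar : x1 != 0 -> (5 <= k.+2)%N -> orb k.+2 (mk (chart k.+2 x1 x2 x3 x4)).
  move=> a0 j5; exists 0; apply/sorbit_mk; exists x1^-1, 1, 0, 0, 1.
  have e : 1 * 1 - 0 * 0 = 1 :> C by ring.
  split; rewrite ?e ?invr_neq0 ?oner_eq0 //; congr mk.
  rewrite /gact e /base; case: k {rank1} j5 => [|[|[|[|[|k]]]]] // _; rewrite /chart /act /=;
    congr Par; field; rewrite ?a0 //.
by case: k rank1 scalar => [|[|[|k]]] rank1 scalar den0;
  [exact: rank1 | exact: rank1 | exact: rank1 | exact: scalar].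
Qed.

Lemma gact1 P : gact 1 1 0 0 1 P = P.
Proof.
case: P => *; rewrite /gact /act /=.
by rewrite !(mulr1, mul1r, mulr0, mul0r, subr0, oppr0, invr1, expr1n, add0r, addr0).
Qed.

(** With the inverse entries as independent arguments, composition is a polynomial identity free of
    denominators. *)
Lemma act_act (c d g11 g12 g21 g22 h11 h12 h21 h22 c' d' g11' g12' g21' g22' h11' h12' h21' h22'
  : C) P :
  act c d g11 g12 g21 g22 h11 h12 h21 h22 (act c' d' g11' g12' g21' g22' h11' h12' h21' h22' P) =
  act (c * c') (d' * d) (g11 * g11' + g12 * g21') (g11 * g12' + g12 * g22')
    (g21 * g11' + g22 * g21') (g21 * g12' + g22 * g22')
    (h11' * h11 + h12' * h21) (h11' * h12 + h12' * h22)
    (h21' * h11 + h22' * h21) (h21' * h12 + h22' * h22) P.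
Proof. by case: P => *; rewrite /act; congr Par; ring. Qed.

Lemma gact_gact (c g11 g12 g21 g22 c' g11' g12' g21' g22' : C) P :
  c != 0 -> g11 * g22 - g12 * g21 != 0 -> c' != 0 -> g11' * g22' - g12' * g21' != 0 ->
  gact c g11 g12 g21 g22 (gact c' g11' g12' g21' g22' P) =
  gact (c * c') (g11 * g11' + g12 * g21') (g11 * g12' + g12 * g22')
    (g21 * g11' + g22 * g21') (g21 * g12' + g22 * g22') P.
Proof.
move=> c0 D0 c0' D0'.
have e : (g11 * g11' + g12 * g21') * (g21 * g12' + g22 * g22')
    - (g11 * g12' + g12 * g22') * (g21 * g11' + g22 * g21')
  = (g11 * g22 - g12 * g21) * (g11' * g22' - g12' * g21') by ring.
by rewrite {1 2}/gact act_act /gact e; congr act; field; rewrite ?c0 ?c0' ?D0 ?D0'.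
Qed.

Lemma sorbit_refl P : sorbit (mk P) (mk P).
Proof.
apply/sorbit_mk; exists 1, 1, 0, 0, 1; rewrite gact1 oner_eq0.
by split=> //; rewrite mulr1 mul0r subr0 oner_eq0.
Qed.

Lemma sorbit_trans P nu xi : sorbit (mk P) nu -> sorbit nu xi -> sorbit (mk P) xi.
Proof.
case/sorbit_mk => c' [g11' [g12' [g21' [g22' [c0' D0' ->]]]]].
case/sorbit_mk => c [g11 [g12 [g21 [g22 [c0 D0 ->]]]]].
apply/sorbit_mk; rewrite gact_gact //.
exists (c * c'), (g11 * g11' + g12 * g21'), (g11 * g12' + g12 * g22').
exists (g21 * g11' + g22 * g21'), (g21 * g12' + g22 * g22').
have e : (g11 * g11' + g12 * g21') * (g21 * g12' + g22 * g22')
    - (g11 * g12' + g12 * g22') * (g21 * g11' + g22 * g21')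
  = (g11 * g22 - g12 * g21) * (g11' * g22' - g12' * g21') by ring.
by split; rewrite ?e ?mulf_neq0.
Qed.

Lemma sorbit_sym P nu : sorbit (mk P) nu -> sorbit nu (mk P).
Proof.
case/sorbit_mk => c [g11 [g12 [g21 [g22 [c0 D0 ->]]]]].
pose D := g11 * g22 - g12 * g21; have {}D0 : D != 0 by [].
apply/sorbit_mk; exists c^-1, (g22 / D), (- g12 / D), (- g21 / D), (g11 / D).
have e : g22 / D * (g11 / D) - - g12 / D * (- g21 / D) = D^-1.
  by rewrite /D; field; rewrite D0.
split; rewrite ?e ?invr_neq0 //; congr mk; rewrite gact_gact ?e ?invr_neq0 // -[LHS]gact1.
by congr gact; rewrite /D; field; rewrite ?c0 ?D0.
Qed.
End Orbits.

(** * Components *)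

Definition map_par (K L : Type) (f : K -> L) (P : par K) : par L :=
  let: Par a l11 l12 l21 l22 r11 r12 r21 r22 b11 b12 b21 b22 := P in
  Par (f a) (f l11) (f l12) (f l21) (f l22) (f r11) (f r12) (f r21) (f r22)
    (f b11) (f b12) (f b21) (f b22).

Lemma mk_map (K L : nzRingType) (f : {rmorphism K -> L}) P t :
  f (mk P t) = mk (map_par f P) t.
Proof.
case: t => [[i j] k]; case: P => *.
by elim/ord3_ind: i; elim/ord3_ind: j; elim/ord3_ind: k; rewrite /= ?rmorph0.
Qed.

Lemma map_nil_par (K L : comNzRingType) (f : {rmorphism K -> L}) v1 v2 p q b :
  map_par f (nil_par v1 v2 p q b) = nil_par (f v1) (f v2) (f p) (f q) (f b).
Proof. by rewrite /nil_par /= !(rmorph0, rmorphN, rmorphM, rmorphXn). Qed.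

Lemma map_chart (K L : comNzRingType) (f : {rmorphism K -> L}) k x1 x2 x3 x4 :
  map_par f (chart k x1 x2 x3 x4) = chart k (f x1) (f x2) (f x3) (f x4).
Proof.
case: k => [|[|k]]; first by rewrite /= rmorph0.
  by rewrite /chart map_nil_par rmorph1.
by case: k => [|[|[|[|[|k]]]]]; rewrite /= ?(rmorph0, rmorphD, rmorphM).
Qed.

Lemma map_chart_den (K L : comNzRingType) (f : {rmorphism K -> L}) k x1 x2 x3 x4 :
  f (chart_den k x1 x2 x3 x4) = chart_den k (f x1) (f x2) (f x3) (f x4).
Proof.
by case: k => [|[|[|[|[|k]]]]]; rewrite //=
  ?(rmorph_nat, rmorphXn, rmorphB, rmorphD, rmorphM).
Qed.

Section Components.
Variable R : realType.
Local Notation C := (R[i]).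
Local Notation struct := (struct R).

Definition img k : struct -> Prop := fun mu => exists x1 x2 x3 x4, mu = mk (chart k x1 x2 x3 x4).

Definition segment (x y : C) : {poly C} := x%:P + 'X * (y - x)%:P.

(** Packaged as a ring morphism, so that a chart over [{poly C}] specialises to the chart at the
    evaluated coordinates. *)
Definition evalp t : {rmorphism {poly C} -> C} := horner_eval t.

Lemma segment_at x y t : evalp t (segment x y) = x + t * (y - x).
Proof. by rewrite /= /horner_eval /segment !hornerE. Qed.

Definition chart_curve k (x1 x2 x3 x4 y1 y2 y3 y4 : C) : curve R :=
  mk (chart k (segment x1 y1) (segment x2 y2) (segment x3 y3) (segment x4 y4)).

Lemma chart_curve_at k x1 x2 x3 x4 y1 y2 y3 y4 t :
  at_ (chart_curve k x1 x2 x3 x4 y1 y2 y3 y4) t =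
  mk (chart k (x1 + t * (y1 - x1)) (x2 + t * (y2 - x2)) (x3 + t * (y3 - x3)) (x4 + t * (y4 - x4))).
Proof.
apply: boolp.funext => i; rewrite /at_ -[LHS]/(evalp t _) mk_map map_chart.
by rewrite !segment_at.
Qed.

Lemma zirreducible_img k : zirreducible (img k).
Proof.
apply: zirreducible_curve; first by exists (mk (chart k 0 0 0 0)), 0, 0, 0, 0.
move=> _ _ [x1 [x2 [x3 [x4 ->]]]] [y1 [y2 [y3 [y4 ->]]]].
exists (chart_curve k x1 x2 x3 x4 y1 y2 y3 y4); split=> [||t]; rewrite chart_curve_at.
- by rewrite !mul0r !addr0.
- by rewrite !mul1r !subrKC.
by eexists _, _, _, _.
Qed.

(** A segment in parameter space leads to a generic point. The denominator along it is a nonzero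
    polynomial, because its value at 1 is nonzero. *)
Lemma img_sub_orb k : ssubset (img k) (zclosure (orb (R := R) k)).
Proof.
apply: sub_zclosure_curve => _ [x1 [x2 [x3 [x4 ->]]]].
have [y1 [y2 [y3 [y4 den0]]]] : exists y1 y2 y3 y4 : C, chart_den k y1 y2 y3 y4 != 0.
  case: k => [|[|k]]; first exists 1, 1, 0, 0; [|exists 0, 1, 0, 1|exists 1, 0, 1, 0].
  - by rewrite /= !(mulr0, mulr1, mul1r, addr0, subr0, expr1n) oner_eq0.
  - by rewrite /= !(mulr0, mulr1, mul1r, addr0, subr0, expr1n) oner_eq0.
  - by case: k => [|[|[|k]]]; rewrite /= ?(mulr0, mulr1, addr0) ?oner_eq0.
exists (chart_curve k x1 x2 x3 x4 y1 y2 y3 y4).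
exists (chart_den k (segment x1 y1) (segment x2 y2) (segment x3 y3) (segment x4 y4)).
have denE t : (chart_den k (segment x1 y1) (segment x2 y2) (segment x3 y3) (segment x4 y4)).[t]
    = chart_den k (x1 + t * (y1 - x1)) (x2 + t * (y2 - x2)) (x3 + t * (y3 - x3)) (x4 +
      t * (y4 - x4)).
  by rewrite -[LHS]/(evalp t _) map_chart_den !segment_at.
split=> [||t]; rewrite ?chart_curve_at.
- by apply: contraNneq den0 => den0; have := denE 1; rewrite den0 horner0 !mul1r !subrKC => <-.
- by rewrite !mul0r !addr0.
by rewrite denE => /chart_orb.
Qed.

(** Shifting [v1] along a line makes it nonzero; then v can be normalised to (1, v2 / v1), with p, q
    and b multiplied by [v1 ^+ 2]. *)
Lemma nil_sub_img : ssubset (fun mu => exists v1 v2 p q b : C, mu = mk (nil_par v1 v2 p q b))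
  (zclosure (img 1)).
Proof.
apply: sub_zclosure_curve => _ [v1 [v2 [p [q [b ->]]]]].
exists (mk (nil_par ('X + v1%:P) v2%:P p%:P q%:P b%:P)), ('X + v1%:P).
have curveE t : at_ (mk (nil_par ('X + v1%:P) v2%:P p%:P q%:P b%:P)) t = mk (nil_par (t +
  v1) v2 p q b).
  apply: boolp.funext => i; rewrite /at_ -[LHS]/(evalp t _) mk_map map_nil_par.
  by rewrite /= /horner_eval !hornerE.
split=> [||t]; rewrite ?curveE ?add0r //; first by rewrite -size_poly_eq0 size_XaddC.
rewrite !hornerE; move: (t + v1) => v v0.
exists (v2 / v), (p * v ^+ 2), (q * v ^+ 2), (b * v ^+ 2); congr mk.
by rewrite /chart /nil_par; congr Par; field.
Qed.

Definition cl k : struct -> Prop := zclosure (orb k).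

Lemma orb_sub_img k : ssubset (orb k) (zclosure (img k)).
Proof.
move=> nu; have [->|k1] := eqVneq k 1%N; first by move/orb_nil/nil_sub_img.
by move=> h; apply: sub_zclosure; exact: orb_chart k1 h.
Qed.

Lemma cl_img k : seteq (cl k) (zclosure (img k)).
Proof.
by move=> mu; split; apply: zclosure_sub; [exact: orb_sub_img | exact: img_sub_orb].
Qed.

Lemma zclosed_cl k : zclosed (cl k).
Proof. exact: zclosed_zclosure. Qed.

Lemma zirreducible_cl k : zirreducible (cl k).
Proof.
rewrite (_ : cl k = zclosure (img k)); first exact/zirreducible_zclosure/zirreducible_img.
by apply: boolp.funext => mu; apply: boolp.propext; exact: cl_img.
Qed.

Lemma cl_Var k : ssubset (cl k) (@Var R).
Proof.
move=> mu /cl_img; apply: zclosure_min; first exact: zclosed_Var.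
by move=> _ [x1 [x2 [x3 [x4 ->]]]]; exact: chart_Var.
Qed.

Lemma Var_cl mu : Var mu -> exists k : 'I_8, cl k mu.
Proof.
case/(@Var_chart R) => [[k k8 h]|h].
  by exists (Ordinal k8); apply: img_sub_orb.
exists (Ordinal (isT : 1 < 8)%N); apply/cl_img; exact: nil_sub_img.
Qed.

Lemma comp8E (k : 'I_8) : @comp8 R k = cl k.
Proof.
have eqc (S T : struct -> Prop) : seteq S T -> zclosure S = zclosure T.
  by move=> e; congr zclosure; apply: boolp.funext => mu; apply: boolp.propext; exact: e.
have eqs (S : struct) j : S = mk (base j 0) -> (forall a : C, base j a = base j 0) ->
    seteq (sorbit S) (orb j).
  by move=> -> bj mu; split=> [h|[a]]; [exists 0 | rewrite bj].
have eqf (F : C -> struct) j : (forall a, F a = mk (base j a)) -> seteq (fam_orbit F) (orb j).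
  by move=> FE mu; split=> -[a h]; exists a; move: h; rewrite FE.
have mkE (S : struct) P : (forall i j l, S (i, j, l) = mk P (i, j, l)) -> S = mk P.
  by move=> e; apply: boolp.funext => -[[i j] l].
case: k => -[|[|[|[|[|[|[|[|//]]]]]]]] lt; apply: eqc.
- apply: eqf => a; apply: mkE => i j l.
  by elim/ord3_ind: i; elim/ord3_ind: j; elim/ord3_ind: l.
- apply: eqf => a; apply: mkE => i j l.
  by elim/ord3_ind: i; elim/ord3_ind: j; elim/ord3_ind: l => //=; ring.
all: apply: eqs => //; apply: mkE => i j l;
  elim/ord3_ind: i; elim/ord3_ind: j; elim/ord3_ind: l => //=; ring.
Qed.

End Components.

(* Multiplicities of the eigenvalue a of lam and rho on the charts 2, ..., 7. *)
Definition lmult k := nth 0%N [:: 0; 0; 0; 1; 1; 0; 0; 2]%N k.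
Definition rmult k := nth 0%N [:: 0; 0; 1; 2; 1; 0; 2; 2]%N k.

Lemma mult_inj k l : (1 < k < 8)%N -> (1 < l < 8)%N ->
  lmult k = lmult l -> rmult k = rmult l -> k = l.
Proof. by do 8?[case: k => [//|k]]; do 8?[case: l => [//|l]]. Qed.

(** * Maximality of the eight closures and rigidity *)

Section Main.
Variable R : realType.
Local Notation C := (R[i]).
Local Notation struct := (struct R).

Definition unit_coef (mu : struct) : C := mu (o0, o0, o0).
Definition ltrace (mu : struct) : C := mu (o0, o1, o1) + mu (o0, o2, o2).
Definition rtrace (mu : struct) : C := mu (o1, o0, o1) + mu (o2, o0, o2).

Lemma polyfun_unit : polyfun unit_coef. Proof. exact: pf_coord. Qed.
Lemma polyfun_ltrace : polyfun ltrace. Proof. by apply: pf_add; exact: pf_coord. Qed.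
Lemma polyfun_rtrace : polyfun rtrace. Proof. by apply: pf_add; exact: pf_coord. Qed.

Lemma chart_traces k (x1 x2 x3 x4 : C) (mu := mk (chart k x1 x2 x3 x4)) : (1 < k < 8)%N ->
  ltrace mu = (lmult k)%:R * unit_coef mu /\ rtrace mu = (rmult k)%:R * unit_coef mu.
Proof.
rewrite {}/mu /ltrace /rtrace /unit_coef.
by do 8?[case: k => [//|k]] => // _; rewrite /lmult /rmult /=; split; ring.
Qed.

Lemma cl_eq0 k (f : struct -> C) : polyfun f ->
  (forall x1 x2 x3 x4, f (mk (chart k x1 x2 x3 x4)) = 0) -> forall mu, cl k mu -> f mu = 0.
Proof.
move=> pf f0 mu /cl_img; apply: (zclosure_min (zclosed_eq pf)).
by move=> _ [x1 [x2 [x3 [x4 ->]]]].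
Qed.

Lemma cl_traces k mu : (1 < k < 8)%N -> cl k mu ->
  ltrace mu = (lmult k)%:R * unit_coef mu /\ rtrace mu = (rmult k)%:R * unit_coef mu.
Proof.
move=> k8 cmu; split; apply/eqP; rewrite -subr_eq0; apply/eqP.
  apply: (@cl_eq0 k (fun nu => ltrace nu - (lmult k)%:R * unit_coef nu)) cmu.
    by apply: polyfun_sub; [exact: polyfun_ltrace | exact: (pf_mul (pf_const _) polyfun_unit)].
  by move=> x1 x2 x3 x4; have [-> _] := chart_traces x1 x2 x3 x4 k8; rewrite subrr.
apply: (@cl_eq0 k (fun nu => rtrace nu - (rmult k)%:R * unit_coef nu)) cmu.
  by apply: polyfun_sub; [exact: polyfun_rtrace | exact: (pf_mul (pf_const _) polyfun_unit)].
by move=> x1 x2 x3 x4; have [_ ->] := chart_traces x1 x2 x3 x4 k8; rewrite subrr.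
Qed.

Lemma cl_base k a : cl k (mk (base k a) : struct).
Proof. by apply: sub_zclosure; exists a; exact: sorbit_refl. Qed.

(** The point [base k 0] is tested against closed conditions. B = 0 holds for [l >= 2] and a = 0 for
    [l < 2]; lam = 0 holds for [l = 0] and symmetry of B for [l = 1]. The traces separate the
    indices from 2 on. *)
Lemma cl_inj (k l : 'I_8) : ssubset (cl (R := R) k) (cl l) -> k = l.
Proof.
move=> kl; apply: val_inj => /=; move: (ltn_ord k) (ltn_ord l) kl.
move: (nat_of_ord k) (nat_of_ord l) => {}k {}l k8 l8 kl.
have base_cl (a : C) : cl l (mk (base k a)) by apply: kl; exact: cl_base.
have form0 : (1 < l)%N -> forall i j : 'I_3, i != o0 -> j != o0 ->
  mk (base k (0 : C)) (i, j, o0) = 0.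
  move=> l1 i j i0 j0; apply: (@cl_eq0 l (fun mu => mu (i, j, o0))) (base_cl 0).
    exact: pf_coord.
  move=> x1 x2 x3 x4; move: l1 l8 i0 j0; clear.
  by do 8?[case: l => [//|l]] => // _ _; elim/ord3_ind: i; elim/ord3_ind: j.
have unit0 : (l < 2)%N -> unit_coef (mk (base k 0)) = 0.
  move=> l2; apply: (@cl_eq0 l unit_coef) (base_cl 0); first exact: pf_coord.
  by move=> x1 x2 x3 x4; case: (l) l2 => [|[|]].
have ev0 (t : idx) : l = 0%N -> (forall x1 x2 x3 x4 : C, mk (chart 0 x1 x2 x3 x4) t = 0) ->
    mk (base k (0 : C)) t = 0.
  move=> l0 h; apply: (@cl_eq0 l (fun mu => mu t)) (base_cl 0); first exact: pf_coord.
  by rewrite l0.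
have sym0 : l = 1%N -> mk (base k (0 : C)) (o1, o2, o0) - mk (base k (0 : C)) (o2, o1, o0) = 0.
  move=> l1; apply: (@cl_eq0 l (fun mu => mu (o1, o2, o0) - mu (o2, o1, o0))) (base_cl 0).
    by apply: polyfun_sub; exact: pf_coord.
  by move=> *; rewrite l1 /= subrr.
have [k2|k2] := ltnP k 2.
  have [l2|l2] := ltnP l 2; last first.
    case: k k2 {k8 kl base_cl unit0 ev0 sym0} form0 => [|[|//]] _ /(_ l2).
      by move/(_ o1 o2 isT isT)/eqP; rewrite /= add0r oner_eq0.
    by move/(_ o1 o1 isT isT)/eqP; rewrite /= expr1n mul1r oner_eq0.
  case: k k2 {k8 kl base_cl unit0 form0} ev0 sym0 => [|[|//]] _ ev0 sym0;
    case: l l2 {l8} ev0 sym0 => [|[|//]] _ ev0 sym0 //.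
    have /eqP := sym0 (erefl _); rewrite /= add0r sub0r opprK.
    by rewrite (_ : 1 + 1 = 2%:R) ?pnatr_eq0.
  have /eqP := ev0 (o0, o1, o2) (erefl _) (fun _ _ _ _ => erefl).
  by rewrite /= addr0 !mulNr opprK expr1n mulr1 oner_eq0.
have unit1 : unit_coef (mk (base k 0)) = 1.
  move: k2 k8; clear; rewrite /unit_coef.
  by do 8?[case: k => [//|k]] => // _ _; rewrite /= ?(mulr1, mul0r, addr0).
have [l2|l2] := ltnP l 2; first by move: unit1; rewrite unit0 // => /eqP; rewrite eq_sym oner_eq0.
have k28 : (1 < k < 8)%N by rewrite k2.
have l28 : (1 < l < 8)%N by rewrite l2.
have [] := cl_traces l28 (base_cl 0); have [-> ->] := cl_traces k28 (@cl_base k 0).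
rewrite unit1 !mulr1 => /eqP + /eqP; rewrite !eqr_nat => /eqP lE /eqP rE.
exact: mult_inj.
Qed.

Lemma irr_component_cl Z : irr_component (@Var R) Z <-> exists k : 'I_8, seteq Z (cl k).
Proof.
have cover W : zirreducible W -> ssubset W (@Var R) -> exists k : 'I_8, ssubset W (cl k).
  move=> irrW WV; apply: zirreducible_cover => // [k|mu /WV]; first exact: zclosed_cl.
  exact: Var_cl.
split=> [[cZ [irrZ [ZV maxZ]]]|[k Zk]].
  have [k Zk] := cover _ irrZ ZV; exists k => mu; split; first exact: Zk.
  by move/(maxZ _ (@zclosed_cl R k) (@zirreducible_cl R k) (@cl_Var R k) Zk).
have -> : Z = cl k by apply: boolp.funext => mu; apply: boolp.propext; exact: Zk.
split; first exact: zclosed_cl.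
split; first exact: zirreducible_cl.
split=> [|W cW irrW WV kW]; first exact: cl_Var.
have [l Wl] := cover _ irrW WV.
have kl : k = l by apply: cl_inj => mu /kW/Wl.
by move=> mu; split=> [/Wl|/kW//]; rewrite kl.
Qed.

Lemma orb_base k nu : (1 < k)%N -> orb k nu -> sorbit (mk (base k (0 : C))) nu.
Proof. by case: k => [|[|k]] // _ [a]. Qed.

Lemma orb_unit k nu : (1 < k < 8)%N -> orb (R := R) k nu -> unit_coef nu != 0.
Proof.
move=> /andP[k1 _] /(orb_base k1)/sorbit_mk[c [g11 [g12 [g21 [g22 [c0 _ ->]]]]]].
have -> : unit_coef (mk (gact c g11 g12 g21 g22 (base k 0))) = c * c^-1 ^+ 2 * pa (base k 0).
  by rewrite /unit_coef /gact /act /=; case: (base k 0).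
rewrite !mulf_neq0 ?expf_neq0 ?invr_neq0 //.
case: k k1 => [|[|k]] // _.
by case: k => [|[|[|[|[|k]]]]]; rewrite /= ?(mulr1, mulr0, addr0) oner_eq0.
Qed.

Lemma unit_orb nu : Var nu -> unit_coef nu != 0 -> exists2 k, (1 < k < 8)%N & orb (R := R) k nu.
Proof.
case=> /mk_coords -> H a0; have [k k8 [x1 [x2 [x3 [x4 PE]]]]] := perm_chart_unit H a0.
exists k => //; move: a0; rewrite PE => a0; apply: chart_orb; move: a0.
by do 2?[case: k k8 {PE} => // k k8]; case: k k8 => [|[|[|[|[|[|]]]]]].
Qed.

(* On Var, if a <> 0 then the traces of lam and rho lie in {0, a, 2a}: excluding two
   of these values is an open condition that fixes the third. *)
Definition orbit_poly k (nu : struct) : C := unit_coef nu *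
  (\prod_(j < 3) (if j == lmult k :> nat then 1 else ltrace nu - j%:R * unit_coef nu) *
   \prod_(j < 3) (if j == rmult k :> nat then 1 else rtrace nu - j%:R * unit_coef nu)).

Lemma polyfun_orbit_poly k : polyfun (orbit_poly k).
Proof.
apply: (pf_mul polyfun_unit); apply: pf_mul; apply: polyfun_prod => j; case: (_ == _);
  try exact: pf_const; apply: polyfun_sub; try exact: (pf_mul (pf_const _) polyfun_unit).
  exact: polyfun_ltrace.
exact: polyfun_rtrace.
Qed.

Lemma orbit_polyP k nu : (1 < k < 8)%N -> Var nu ->
  sorbit (mk (base k (0 : C))) nu <-> orbit_poly k nu <> 0.
Proof.
move=> k8 Vnu; split=> [h|/eqP].
  have ok : orb k nu by exists 0; move: h; case: (k) k8 => [|[|]].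
  have a0 := orb_unit k8 ok; have [lE rE] := cl_traces k8 (sub_zclosure ok).
  apply/eqP; rewrite /orbit_poly lE rE !mulf_neq0 //; apply/prodf_neq0 => j _;
    case: (@eqP nat _ _) => [_|/eqP ne]; rewrite ?oner_eq0 //;
    by rewrite -mulrBl mulf_neq0 // subr_eq0 eqr_nat eq_sym.
rewrite /orbit_poly !mulf_eq0 !negb_or => /and3P[a0 /prodf_neq0 ln /prodf_neq0 rn].
have [l l8 ol] := unit_orb Vnu a0.
have [lE rE] := cl_traces l8 (sub_zclosure ol).
suff -> : k = l by apply: orb_base => //; case/andP: l8.
have l3 : (lmult l < 3)%N /\ (rmult l < 3)%N.
  by move: l8; clear; do 8?[case: l => [//|l]].
apply: mult_inj => //; apply/eqP; rewrite eq_sym; apply/negPn/negP => ne.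
  by have := ln (Ordinal l3.1) isT; rewrite /= (negPf ne) lE subrr eqxx.
by have := rn (Ordinal l3.2) isT; rewrite /= (negPf ne) rE subrr eqxx.
Qed.

Lemma rigid_base k mu : (1 < k < 8)%N -> sorbit (mk (base k (0 : C))) mu -> rigid (@Var R) mu.
Proof.
move=> k8 bmu.
have Vmu : Var mu.
  by apply: (@cl_Var R k); apply: sub_zclosure; exists 0; move: bmu; case: (k) k8 => [|[|]].
split=> //; exists (fun nu => orbit_poly k nu = 0); split.
  exact/zclosed_eq/polyfun_orbit_poly.
move=> nu Vnu; rewrite -(orbit_polyP k8 Vnu).
have muE := mk_coords Vmu.1.
split=> [h|h]; first exact: sorbit_trans bmu h.
by move: bmu; rewrite muE => bmu; apply: sorbit_trans (sorbit_sym bmu) h.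
Qed.

(** If the orbit were the complement of [Z] in the variety, the irreducible set [cl k] would be
    covered by [Z] and the zero set of [h]. But [mu] is outside the first and [nu] outside the
    second. *)
Lemma not_rigid k mu (h : struct -> C) : cl k mu -> polyfun h ->
  (forall nu, sorbit mu nu -> h nu = 0) -> (exists2 nu, cl k nu & h nu != 0) ->
  ~ rigid (@Var R) mu.
Proof.
move=> kmu ph h0 [nu knu hnu] [Vmu [Z [cZ Zorb]]].
have [_ irr] := @zirreducible_cl R k.
have [|Zmu|hk] := irr _ _ cZ (zclosed_eq ph).
- move=> xi kxi; apply: boolp.contrapT => /boolp.not_orP[nZ nh].
  by apply/nh/h0; apply/Zorb => //; exact: cl_Var kxi.
- have /(Zorb _ Vmu)[] : sorbit mu mu by rewrite (mk_coords Vmu.1); exact: sorbit_refl.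
  exact: Zmu.
by case/eqP: hnu; exact: hk.
Qed.

(* lam : rho is constant on the orbit. *)
Lemma nil_not_rigid (v1 v2 p q b : C) : (p != 0) || (q != 0) ->
  ~ rigid (@Var R) (mk (nil_par v1 v2 p q b)).
Proof.
move=> pq; apply: (@not_rigid 1%N _ (fun nu => q * nu (o0, o2, o1) - p * nu (o2, o0, o1))).
- by apply/cl_img; apply: (@nil_sub_img R (mk _)); exists v1, v2, p, q, b.
- by apply: polyfun_sub; apply: pf_mul; [exact: pf_const | exact: pf_coord | exact: pf_const |
  exact: pf_coord].
- move=> nu /sorbit_mk[c [g11 [g12 [g21 [g22 [_ _ ->]]]]]].
  by rewrite /gact /act /nil_par /=; ring.
have nE (p' q' : C) : exists2 nu, cl 1 nu & nu (o0, o2, o1) = p' /\ nu (o2, o0, o1) = q'.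
  exists (mk (chart 1 0 p' q' 0)); first by apply: img_sub_orb; exists 0, p', q', 0.
  by rewrite /= expr1n !mulr1.
case/orP: pq => [p0|q0].
  by have [nu knu [nu1 nu2]] := nE 0 1; exists nu; rewrite // nu1 nu2 mulr0 mulr1 sub0r oppr_eq0.
by have [nu knu [nu1 nu2]] := nE 1 0; exists nu; rewrite // nu1 nu2 mulr0 mulr1 subr0.
Qed.

Definition form_det (nu : struct) : C :=
  4 * nu (o1, o1, o0) * nu (o2, o2, o0) - (nu (o1, o2, o0) + nu (o2, o1, o0)) ^+ 2.
Definition form_pf (nu : struct) : C := (nu (o1, o2, o0) - nu (o2, o1, o0)) ^+ 2.

(* The ratio of [form_det] to [form_pf] is constant on the orbit. *)
Lemma form_not_rigid (x1 x2 x3 x4 : C) : ~ rigid (@Var R) (mk (chart 0 x1 x2 x3 x4)).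
Proof.
set mu : struct := mk _.
have [A [B [AB rel]]] : exists A B, ((A != 0) || (B != 0)) /\ A * form_det mu + B * form_pf mu = 0.
  have [d0|d0] := eqVneq (form_det mu) 0.
    by exists 1, 0; rewrite oner_eq0 d0 mulr0 mul0r addr0.
  by exists (- form_pf mu), (form_det mu); rewrite d0 orbT; split=> //; ring.
apply: (@not_rigid 0%N _ (fun nu => A * form_det nu + B * form_pf nu)).
- by apply: img_sub_orb; exists x1, x2, x3, x4.
- have pc := @pf_coord R; have pk := @pf_const R.
  apply: pf_add; apply: pf_mul => //.
    apply: polyfun_sub; first by do 2?[apply: pf_mul => //].
    by apply: polyfun_exp; apply: pf_add.
  by apply: polyfun_exp; apply: polyfun_sub.
- move=> nu /sorbit_mk[c [g11 [g12 [g21 [g22 [c0 D0 ->]]]]]].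
  set D := g11 * g22 - g12 * g21 in D0.
  transitivity ((c / D) ^+ 2 * (A * form_det mu + B * form_pf mu)); last by rewrite rel mulr0.
  rewrite /form_det /form_pf /mu /gact /act /=.
  by rewrite /D; field; rewrite D0.
have nE (y1 y2 y3 y4 : C) : cl 0 (mk (chart 0 y1 y2 y3 y4)).
  by apply: img_sub_orb; exists y1, y2, y3, y4.
have four0 : (4 : C) != 0 by rewrite pnatr_eq0.
case/orP: AB => [A0|B0].
  exists (mk (chart 0 1 0 0 1)) => //; rewrite /form_det /form_pf /=.
  by rewrite !(mulr1, addr0, subr0, expr0n, mulr0) mulf_neq0.
exists (mk (chart 0 0 1 (- 1) 0)) => //; rewrite /form_det /form_pf /=.
have -> : A * (4 * 0 * 0 - (1 - 1) ^+ 2) + B * (1 - -1) ^+ 2 = B * 4 by ring.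
by rewrite mulf_neq0.
Qed.

Lemma rigid_orb mu : rigid (@Var R) mu -> exists2 k, (1 < k < 8)%N & sorbit (mk (base k (0 : C)))
  mu.
Proof.
move=> rmu; have [[ev H] _] := rmu.
have [a0|a0] := eqVneq (unit_coef mu) 0; last first.
  by have [k k8 ok] := unit_orb rmu.1 a0; exists k => //; apply: orb_base => //; case/andP: k8.
have muE := mk_coords ev; rewrite muE in H rmu.
have [[x1 [x2 [x3 [x4 PE]]]]|[v1 [v2 [p [q [b PE]]]]]] := perm_chart_nil H a0.
  by rewrite PE in rmu; case: (form_not_rigid rmu).
rewrite PE in rmu; have [pq|] := boolP ((p != 0) || (q != 0)).
  by case: (nil_not_rigid pq rmu).
(* If lam = rho = 0, the structure is a bare form and belongs to chart 0. *)
rewrite negb_or !negbK => /andP[/eqP p0 /eqP q0]; move: rmu; rewrite p0 q0.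
have -> : nil_par v1 v2 0 0 b
    = chart 0 (b * v2 ^+ 2) (- (b * v1 * v2)) (- (b * v1 * v2)) (b * v1 ^+ 2).
  by rewrite /nil_par /chart !mul0r oppr0.
by move/form_not_rigid.
Qed.

End Main.

(** * The dimension and the final assembly *)

Section Chains.
Variable R : realType.
Local Notation C := (R[i]).
Local Notation struct := (struct R).

Definition form_idx : seq idx := [:: (o1, o1, o0); (o1, o2, o0); (o2, o1, o0); (o2, o2, o0)].

(** Coordinate subspaces of the linear space of all forms B with a = lam = rho = 0; for [m <= 4] the
    dimension is [m]. *)
Definition flag m : struct -> Prop := fun mu => forall t, t \notin take m form_idx -> mu t = 0.

Lemma flag_Var m mu : flag m mu -> Var mu.
Proof.
move=> fm; have f0 t : t \notin form_idx -> mu t = 0.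
  by move=> ht; apply: fm; apply: contra ht; exact: mem_take.
suff -> : mu = mk (chart 0 (mu (o1, o1, o0)) (mu (o1, o2, o0)) (mu (o2, o1, o0)) (mu (o2, o2, o0))).
  exact: chart_Var.
apply: boolp.funext => -[[i j] k].
by elim/ord3_ind: i; elim/ord3_ind: j; elim/ord3_ind: k => //; apply: f0.
Qed.

Lemma has_chain_Var : has_chain (@Var R) 4.
Proof.
exists flag; split=> m m4.
  split.
    apply: zclosed_inter => t; apply: zclosed_inter => _.
    exact/zclosed_eq/pf_coord.
  split; last exact: flag_Var.
  apply: zirreducible_curve; first by exists (fun=> 0).
  move=> mu nu fmu fnu; exists (fun t => segment (mu t) (nu t)).
  have segE s t : (segment (mu t) (nu t)).[s] = mu t + s * (nu t - mu t) by exact: segment_at.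
  split=> [||s t ht]; rewrite /at_.
  - by apply: boolp.funext => t; rewrite segE mul0r addr0.
  - by apply: boolp.funext => t; rewrite segE mul1r subrKC.
  - by rewrite segE fmu ?fnu // subr0 mulr0 addr0.
have sm : (m < size form_idx)%N by [].
have x0 : idx := (o1, o1, o0).
split=> [mu fmu t|h].
  by rewrite (take_nth x0) // mem_rcons inE negb_or => /andP[_ /fmu].
pose e : struct := fun t => (t == nth x0 form_idx m)%:R.
have fe : flag m.+1 e.
  move=> t; rewrite (take_nth x0) // mem_rcons inE negb_or => /andP[/negPf ne _].
  by rewrite /e ne.
have : uniq (take m.+1 form_idx) by apply: take_uniq.
rewrite (take_nth x0) // rcons_uniq => /andP[nin _].
by have /eqP := h _ fe _ nin; rewrite /e eqxx oner_eq0.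
Qed.

Lemma chart_sepdeg k t : exists d, sepdeg d (fun x : 'I_4 -> C =>
  mk (chart k (x (inord 0)) (x (inord 1)) (x (inord 2)) (x (inord 3))) t).
Proof.
pose bounded (f : ('I_4 -> C) -> C) := exists d, sepdeg d f.
have bc c : bounded (fun=> c) by exists 0%N; exact: sepdeg_const.
have bx i : bounded (fun x => x i) by exists 1%N; exact: sepdeg_coord.
have bM f g : bounded f -> bounded g -> bounded (fun x => f x * g x).
  by move=> [d fd] [e ge]; exists (d + e)%N; exact: sepdegM.
have bD f g : bounded f -> bounded g -> bounded (fun x => f x + g x).
  move=> [d fd] [e ge]; exists (d + e)%N.
  by apply: sepdegD; [apply: sepdegW fd | apply: sepdegW ge]; lia.
have bN f : bounded f -> bounded (fun x => - f x).
  by move=> bf; have := bM _ _ (bc (-1)) bf; congr bounded; apply: boolp.funext => x;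
    rewrite mulN1r.
have bX f n : bounded f -> bounded (fun x => f x ^+ n).
  by move=> [d fd]; exists (n * d)%N; exact: sepdegX.
rewrite -/(bounded _); case: t => [[i j] l].
case: k => [|[|[|[|[|[|[|k]]]]]]];
  elim/ord3_ind: i; elim/ord3_ind: j; elim/ord3_ind: l; rewrite /= ;
  by repeat first [apply: (bc) | apply: (bx) | apply: (bD) | apply: (bN) | apply: (bX) |
    apply: (bM)].
Qed.

Lemma has_dim_Var : has_dim (@Var R) 4.
Proof.
split; first exact: has_chain_Var.
apply: (@has_chainPn R 4 _ 8 (fun k x =>
  mk (chart k (x (inord 0)) (x (inord 1)) (x (inord 2)) (x (inord 3))))) => [k t|mu Vmu].
  exact: chart_sepdeg.
have [k kmu] := Var_cl Vmu; exists k; move: kmu => /cl_img; apply: zclosure_sub.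
move=> _ [x1 [x2 [x3 [x4 ->]]]]; apply: sub_zclosure.
exists (fun i => nth 0 [:: x1; x2; x3; x4] i).
by rewrite !inordK.
Qed.

Lemma rig6E (k : 'I_6) : @rig6 R k = mk (base k.+2 0).
Proof.
apply: boolp.funext => -[[i j] l]; case: k => -[|[|[|[|[|[|//]]]]]] lt;
  elim/ord3_ind: i; elim/ord3_ind: j; elim/ord3_ind: l => //=; ring.
Qed.
End Chains.

Theorem mainTheorem7 (R : realType) :
  has_dim (@Var R) 4 /\
  (forall Z, irr_component (@Var R) Z <-> exists k : 'I_8, seteq Z (@comp8 R k)) /\
  (forall k l : 'I_8, seteq (@comp8 R k) (@comp8 R l) -> k = l) /\
  (forall mu, rigid (@Var R) mu <-> exists k : 'I_6, sorbit (@rig6 R k) mu) /\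
  (forall k l : 'I_6, sorbit (@rig6 R k) (@rig6 R l) -> k = l).
Proof.
(* The rigid structure of index [k] is the base point of component [k + 2]. *)
have k28 (k : 'I_6) : (1 < k.+2 < 8)%N by have := ltn_ord k; lia.
split; first exact: has_dim_Var.
split.
  move=> Z; rewrite irr_component_cl.
  by split=> -[k Zk]; exists k; [rewrite comp8E | rewrite -comp8E].
split; first by move=> k l kl; apply: cl_inj; rewrite -!comp8E => mu /kl.
split=> [mu|k l].
  split=> [/rigid_orb[k /andP[k2 k8] bmu]|[k]]; last by rewrite rig6E; exact: rigid_base.
  have k6 : (k - 2 < 6)%N by lia.
  by exists (Ordinal k6); rewrite rig6E /=; move: bmu; case: (k) k2 => [|[|j]] //= _;
    rewrite !subSS subn0.
(* Isomorphic structures have equal traces, and dividing by the nonzero a compares the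
   multiplicities. *)
rewrite !rig6E => kl; have okl : orb k.+2 (mk (base l.+2 (0 : R[i]))) by exists 0.
have [lE rE] := cl_traces (k28 k) (sub_zclosure okl).
have [] := cl_traces (k28 l) (@cl_base R l.+2 0); rewrite lE rE => le re.
have u0 := orb_unit (k28 k) okl.
have [le' re'] := (mulIf u0 le, mulIf u0 re).
apply: val_inj; apply/eqP; rewrite -2!eqSS; apply/eqP.
by apply: (mult_inj (k28 k) (k28 l)); apply/eqP; [move: le' | move: re'] => /eqP; rewrite eqr_nat.
Qed.
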